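(* Let $r\ge 1$ and $d\ge 1$ be integers. Then, as an identity of formal power series in the independent indeterminates $v$ and $\bar v$, $$\sum_{n=0}^{\infty}\frac{A_{d+1,r}(n)}{(rn)!\,n!}(v\bar v)^{rn} = \frac{1}{\pi^{r}}\underbrace{\int_{\mathbb C}\cdots\int_{\mathbb C}}_{r}\det\big(T_d(v,\mathbf t)\big)\cdot \exp\left(\bar v^{\,r}\,\overline{\mathrm{Cyc}_{r}(\mathbf t)}\right)\prod_{j=1}^{r}e^{-|t_j|^2}\,dA(t_j),$$ where $\mathbf t=(t_1,\ldots,t_r)$ and $T_d(v,\mathbf t)$ is the $d\times d$ Toeplitz matrix with entries $$(T_d(v,\mathbf t))_{ij}=\varphi_{i-j}(v,\mathbf t),\qquad 1\le i,j\le d,$$ associated with the formal Toeplitz symbol $$\varphi(v,\mathbf t;z)=\sum_{m=-\infty}^{\infty}\varphi_m(v,\mathbf t)z^m=\exp\left(\frac{v}{z}+\sum_{j=1}^{r}t_jz^j\right).$$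
   Context: For positive integers $n,d,r$, $A_{d,r}(n)$ is the number of words of length $rn$ in the alphabet $\{1,2,\ldots,n\}$ such that each letter appears exactly $r$ times and there is no strictly increasing subsequence of length $d$ (subsequences need not be contiguous). For $n=0$ only the empty word is counted, so $A_{d,r}(0)=1$. The cycle index polynomial of the symmetric group $S_r$ is $$\mathrm{Cyc}_r(t_1,\ldots,t_r)=\frac{1}{r!}\sum_{|\mu|=r}|C_\mu|\prod_{i=1}^{\ell(\mu)}t_{\mu_i},$$ the sum being over partitions $\mu$ of $r$, where $C_\mu\subset S_r$ is the conjugacy class of permutations of cycle type $\mu$ and $\ell(\mu)$ is the number of parts of $\mu$. $dA$ is the area (Lebesgue) measure in the complex plane $\mathbb C$. The bar over $\mathrm{Cyc}_r(\mathbf t)$ denotes complex conjugation, with $t_1,\ldots,t_r$ the complex integration variables. The symbols $v$ and $\bar v$ are treated as independent bookkeeping indeterminates ($\bar v$ is not the complex conjugate of $v$). The coefficients $\varphi_m(v,\mathbf t)$ are formal power series in $v$ with coefficients polynomial in $\mathbf t$, obtained by multiplying the expansions of $\exp(v/z)$ and $\exp(\sum_{j=1}^r t_jz^j)$ and collecting powers of $z$. Explicitly, $\varphi_m(v,\mathbf t)=\sum_{k\ge \max(0,-m)}h_{k+m}(\mathbf t)\frac{v^k}{k!}$, where $\sum_{k\ge0}h_k(\mathbf t)z^k=\exp(\sum_{j=1}^r t_jz^j)$. The right-hand side of the identity is interpreted coefficientwise: the integrand $\det(T_d(v,\mathbf t))\exp(\bar v^{\,r}\overline{\mathrm{Cyc}_r(\mathbf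 t)})$ is expanded as a formal power series $\sum_{k,l\ge0}F_k(\mathbf t)\overline{G_l(\mathbf t)}v^k\bar v^l$ with $F_k,G_l$ polynomials in $\mathbf t$, and each coefficient is integrated against the Gaussian measure $\pi^{-r}\prod_{j=1}^r e^{-|t_j|^2}dA(t_j)$. *)

(* Defs.v *)
From HB Require Import structures.
From mathcomp Require Import all_boot all_order all_fingroup all_algebra.
From mathcomp Require Import all_classical all_reals all_analysis.
From mathcomp Require Import complex.

Set Implicit Arguments.
Unset Strict Implicit.
Unset Printing Implicit Defensive.

Import Order.TTheory GRing.Theory Num.Theory.
Import numFieldNormedType.Exports.

Local Open Scope ring_scope.
Local Open Scope complex_scope.

(* A formal power series in one indeterminate is the sequence of its
   coefficients.  Series in two independent indeterminates are series with
   coefficients in a ring of series. *)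
Record fps (A : Type) := Fps { fps_coef : nat -> A }.

Arguments Fps {A} _.
Arguments fps_coef {A} _ _.

Notation "\fps_ ( i ) E" := (Fps (fun i : nat => E))
  (at level 36, E at level 36, i at level 50, format "\fps_ ( i )  E").

HB.instance Definition _ (A : Type) := gen_eqMixin (fps A).
HB.instance Definition _ (A : Type) := gen_choiceMixin (fps A).

Lemma fpsP (A : Type) (f g : fps A) : fps_coef f =1 fps_coef g <-> f = g.
Proof.
split=> [|-> //]; case: f g => [f] [g] /= fg.
by congr Fps; apply/funext.
Qed.

Section FpsRing.
Variable A : comNzRingType.
Implicit Types (f g h : fps A) (c : A).

Definition fpsC c : fps A := \fps_(k) (if k == 0%N then c else 0).
Definition fpsX : fps A := \fps_(k) (k == 1%N)%:R.
Definition add_fps f g : fps A := \fps_(k) (fps_coef f k + fps_coef g k).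
Definition opp_fps f : fps A := \fps_(k) - fps_coef f k.
Definition mul_fps f g : fps A :=
  \fps_(k) (\sum_(i < k.+1) fps_coef f i * fps_coef g (k - i)).

Fact add_fpsA : associative add_fps.
Proof. by move=> f g h; apply/fpsP => k; rewrite /= addrA. Qed.
Fact add_fpsC : commutative add_fps.
Proof. by move=> f g; apply/fpsP => k; rewrite /= addrC. Qed.
Fact add_0fps : left_id (fpsC 0) add_fps.
Proof. by move=> f; apply/fpsP => k /=; case: ifP; rewrite add0r. Qed.
Fact add_Nfps : left_inverse (fpsC 0) opp_fps add_fps.
Proof. by move=> f; apply/fpsP => k /=; rewrite addNr; case: ifP. Qed.

HB.instance Definition _ :=
  GRing.isZmodule.Build (fps A) add_fpsA add_fpsC add_0fps add_Nfps.

Fact mul_fpsC : commutative mul_fps.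
Proof.
move=> f g; apply/fpsP => k /=.
rewrite (reindex_inj rev_ord_inj) /=.
by apply: eq_bigr => i _; rewrite mulrC subSS subKn // -ltnS.
Qed.

Fact mul_fpsA : associative mul_fps.
Proof.
move=> f g h; apply/fpsP => k /=.
pose coef3 i j := fps_coef f i * fps_coef g (k - i - j) * fps_coef h j.
transitivity (\sum_(i < k.+1) \sum_(j < k.+1 | (j <= k - i)%N) coef3 i j).
  apply: eq_bigr => i _; rewrite mulr_sumr.
  rewrite (big_ord_narrow_leq (leq_subr _ _)) (reindex_inj rev_ord_inj) /=.
  apply: eq_bigr => j _; rewrite /coef3 !subSS (subKn (leq_ord j)).
  by rewrite mulrA.
rewrite (exchange_big_dep predT) //= [RHS](reindex_inj rev_ord_inj) /=.
apply: eq_bigr => j _; rewrite subSS (subKn (leq_ord j)).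
rewrite (eq_bigl (fun i : 'I_k.+1 => (i <= k - j)%N)); last first.
  by move=> i; rewrite -ltnS -(ltnS i) -!subSn ?leq_ord // !ltn_subRL addnC.
rewrite (big_ord_narrow_leq (leq_subr _ _)) /= mulr_suml.
by apply: eq_bigr => i _; rewrite /coef3 /= -!subnDA addnC.
Qed.

Fact mul_1fps : left_id (fpsC 1) mul_fps.
Proof.
move=> f; apply/fpsP => k /=; rewrite big_ord_recl subn0 mul1r.
by rewrite big1 ?addr0 // => i _; rewrite mul0r.
Qed.

Fact mul_fpsDl : left_distributive mul_fps add_fps.
Proof.
move=> f g h; apply/fpsP => k /=; rewrite -big_split.
by apply: eq_bigr => i _; rewrite mulrDl.
Qed.

Fact fps1_neq0 : fpsC 1 != 0 :> fps A.
Proof.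
by apply/eqP => /(congr1 (fun f => fps_coef f 0%N)) /= /eqP; rewrite oner_eq0.
Qed.

HB.instance Definition _ := GRing.Zmodule_isComNzRing.Build (fps A)
  mul_fpsA mul_fpsC mul_1fps mul_fpsDl fps1_neq0.

(* The infinite sum of the series u_n.  It is meaningful only when the
   indeterminate of [fps A] divides u_n at least n times: the terms with n > k
   then contribute nothing to the coefficient of degree k. *)
Definition fps_sum (u : nat -> fps A) : fps A :=
  \fps_(k) \sum_(n < k.+1) fps_coef (u n) k.

End FpsRing.

Arguments fpsX {A}.

Definition fps_map (A B : Type) (h : A -> B) (f : fps A) : fps B :=
  \fps_(k) h (fps_coef f k).

(* For f without constant term, as [fps_sum] requires. *)
Definition fps_exp (F : fieldType) (f : fps F) : fps F :=
  fps_sum (fun n => fpsC (n`!%:R)^-1 * f ^+ n).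

(* Letters 1, ..., n are represented by the elements 0, ..., n - 1 of 'I_n. *)
Definition avoiding_words (d r n : nat) : {set (r * n).-tuple 'I_n} :=
  [set w : (r * n).-tuple 'I_n |
     [forall a : 'I_n, count_mem a w == r] &&
     ~~ [exists s : d.-tuple 'I_n,
           subseq s w && sorted (fun a b : 'I_n => (a < b)%N) s]].

Definition nb_avoiding (d r n : nat) : nat := #|avoiding_words d r n|.

(* A partition of r is a weakly decreasing sequence of r natural numbers with
   sum r; its parts are the nonzero terms. *)
Definition is_partition (r : nat) (mu : r.-tuple 'I_r.+1) : bool :=
  sorted (fun a b : 'I_r.+1 => (b <= a)%N) mu &&
  (\sum_(i < r) tnth mu i == r)%N.

Definition parts (r : nat) (mu : r.-tuple 'I_r.+1) : seq nat :=
  [seq m <- map val mu | (0 < m)%N].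

Definition cycle_lengths (r : nat) (s : 'S_r) : seq nat :=
  [seq #|pred_of_set B| | B <- enum (porbits s)].

Definition cycle_class (r : nat) (mu : r.-tuple 'I_r.+1) : {set 'S_r} :=
  [set s : 'S_r | perm_eq (cycle_lengths s) (parts mu)].

Section Integrand.
Variables (R : realType) (r : nat).
(* The variable t_j, 1 <= j <= r, is the entry of index j - 1 of t. *)
Implicit Types t : r.-tuple R[i].

Definition Cyc t : R[i] :=
  (r`!%:R)^-1 * \sum_(mu : r.-tuple 'I_r.+1 | is_partition mu)
    #|cycle_class mu|%:R * \prod_(m <- parts mu) nth 0 t m.-1.

Definition hcoef t (k : nat) : R[i] :=
  fps_coef (fps_exp (\sum_(j < r) fpsC (tnth t j) * fpsX ^+ j.+1)) k.

(* The coefficient of z^m in exp (v / z) exp (\sum_j t_j z^j), as a series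
   in v. *)
Definition phi (m : int) t : fps R[i] :=
  \fps_(k) (if k%:Z + m is Posz q then hcoef t q / k`!%:R else 0).

Definition toeplitz (d : nat) t : 'M[fps R[i]]_d :=
  \matrix_(i < d, j < d) phi (i%:Z - j%:Z) t.

(* In [fps (fps R[i])] the outer indeterminate is v, the inner one is \bar v:
   the first factor only involves v and the second one only \bar v. *)
Definition integrand (d : nat) t : fps (fps R[i]) :=
  fps_map (@fpsC _) (\det (toeplitz d t)) *
  fpsC (fps_exp (fpsX ^+ r * fpsC (Num.conj (Cyc t)))).

Definition gauss_weight t : R[i] :=
  (\prod_(j < r) expR (- Normc.normc (tnth t j) ^+ 2))%:C.

End Integrand.

(* Integral of a complex function against the area measure of C = R x R, taken
   on the real and imaginary parts. *)
Definition integralC (R : realType) (f : R[i] -> R[i]) : R[i] :=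
  let dA := (@lebesgue_measure R \x @lebesgue_measure R)%E in
  (\int[dA]_p complex.Re (f (p.1 +i* p.2))) +i*
  (\int[dA]_p complex.Im (f (p.1 +i* p.2))).

Fixpoint iter_integralC (R : realType) (r : nat) :
    (r.-tuple R[i] -> R[i]) -> R[i] :=
  match r with
  | 0 => fun f => f [tuple]
  | r'.+1 => fun f =>
      integralC (fun z => iter_integralC (fun t => f [tuple of z :: t]))
  end.

Definition genfun (R : realType) (d r : nat) : fps (fps R[i]) :=
  let v := fpsX in
  let vbar := fpsC fpsX in
  fps_sum (fun n =>
    fpsC (fpsC ((nb_avoiding d r n)%:R / ((r * n)`!%:R * n`!%:R))) *
    (v * vbar) ^+ (r * n)).

Definition gauss_integral_fps (R : realType) (r : nat)
    (F : r.-tuple R[i] -> fps (fps R[i])) : fps (fps R[i]) :=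
  \fps_(k) \fps_(l)
    ((pi ^- r)%:C * iter_integralC (fun t =>
       fps_coef (fps_coef (F t) k) l * gauss_weight t)).

(* Main.v *)
Require Import Defs.
From HB Require Import structures.
From mathcomp Require Import all_boot all_order all_fingroup all_algebra.
From mathcomp Require Import complex.
From mathcomp Require Import mpoly.
From mathcomp Require Import all_classical all_reals all_analysis.
From mathcomp Require Import measurable_realfun.
From mathcomp Require Import ring zify.

(** The idea.  The coefficient of [v^k \bar v^l] on the right is the Gaussian
    integral of a polynomial in [t_1, ..., t_r] times the conjugate of another
    one.  Monomials are orthogonal for the Gaussian measure, so this integral is
    [pi ^+ r] times an explicit form, [pairing] ([iter_integralC_pairing]), and for
    that form multiplication by [t_j] is adjoint to the derivation with respect
    to [t_j] ([pairing_mulX]).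

    The Toeplitz entries are made of the coefficients [h_m] of
    [exp (\sum_j t_j z^j)], and [t_j]-derivation turns [h_m] into [h_(m - j)]
    ([mderiv_hpolyz]).  Hence derivations act on a product of [h]'s by shifting
    its vector of indices, a point of the lattice [Z^d].  The cycle index is the
    average over the symmetric group of products of variables, one for each
    cycle; counting the colourings fixed by a permutation, the adjoint of
    multiplication by it is found to be the sum, over all vectors [c] of natural
    numbers with sum [r], of the shift by [- c] ([pairing_cycle_poly]).
    Derivation with respect to [v] raises the index of a Toeplitz entry by one, so
    the coefficient of [v^k] in the determinant comes from [k] successive unit
    shifts ([coef_det_toeplitz]).

    So [k! n!] times the coefficient of [v^k \bar v^(r n)] is an alternating sum,
    over permutations [s], of numbers of lattice paths leading from the point
    [(i - s i)_i] to the origin by [k] unit steps up and then [n] steps down of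
    total length [r] each.  Reorganised as a function of the starting point, such a
    sum is antisymmetric under permutations of the coordinates.  This kills every
    path which leaves the chamber of strictly increasing vectors
    ([sum_unit_step]), and the down steps cancel in pairs unless they interlace
    ([sum_lowered_interlacing]).  The paths that remain are the pairs made of a
    standard tableau with [k] boxes and a semistandard tableau of the same shape
    in which each of [n] letters occurs [r] times, with at most [d] rows
    ([pairing_det_hwalk]).  Here the shape [lambda] is encoded by the strictly
    increasing vector [i + lambda_(d - i)].

    There are such pairs only when [k = r n].  The Robinson-Schensted-Knuth
    correspondence then identifies them with the words in which each letter
    occurs [r] times, the number of rows being the length of the longest strictly
    increasing subsequence ([nb_avoiding_walk_sum]).  The correspondence is built
    letter by letter from a local rule on pairs of interlacing vectors, which is
    invertible ([fall_inj], [fall_new_disjoint], [fall_back]) and whose effect on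
    the number of rows is explicit ([new_row], [moved_row]). *)

Set Implicit Arguments.
Unset Strict Implicit.
Unset Printing Implicit Defensive.

Import Order.TTheory GRing.Theory Num.Theory.
Import numFieldNormedType.Exports.
Local Open Scope ring_scope.

Local Open Scope classical_set_scope.
Local Open Scope complex_scope.

(** * Moments of the one-dimensional Gaussian *)

Section RealMoments.
Variable R : realType.
Local Notation mu := (@lebesgue_measure R).

Definition gauss_mono (k : nat) (x : R) : R := x ^+ k * gauss_fun x.

(** Half of the Gaussian decay absorbs any power of [x]: when [`|x| > 1], the
    power is dominated by a single term of the exponential series of [x ^+ 2 / 2]. *)
Lemma normr_expr_le (k : nat) (x : R) :
  `|x ^+ k| <= (1 + 2 ^+ k.+1 * (k.+1)`!%:R) * expR (x ^+ 2 / 2).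
Proof.
have x2 : 0 <= x ^+ 2 / 2 by rewrite divr_ge0 ?sqr_ge0 ?ler0n.
have e1 : 1 <= expR (x ^+ 2 / 2) by rewrite -[leLHS]expR0 ler_expR.
have f0 : 0 < (k.+1)`!%:R :> R by rewrite ltr0n fact_gt0.
have := expR_ge1Dxn k x2; rewrite -lerBrDl => h.
have {}h : (x ^+ 2) ^+ k.+1 <= 2 ^+ k.+1 * (k.+1)`!%:R * expR (x ^+ 2 / 2).
  move: h; rewrite ler_pdivrMr// expr_div_n ler_pdivrMr ?exprn_gt0// => h.
  apply: (le_trans h); rewrite -mulrA mulrC [X in X * _ <= _]mulrC.
  by rewrite ler_wpM2l ?mulr_ge0 ?exprn_ge0 ?ler0n// gerBl.
rewrite mulrDl mul1r normrX; have [x1|x1] := leP `|x| 1.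
  apply: (@le_trans _ _ 1); first exact: exprn_ile1.
  by rewrite -[leLHS]addr0 lerD// (le_trans _ h)// exprn_ge0// sqr_ge0.
apply: (@le_trans _ _ ((x ^+ 2) ^+ k.+1)).
  rewrite -real_normK ?num_real// -exprM ler_weXn2l//; last by lia.
  exact: ltW.
by rewrite -[leLHS]add0r lerD// expR_ge0.
Qed.

Lemma gauss_mono_bound (k : nat) : exists C : R, 0 <= C /\
  forall x, `|gauss_mono k x| <= C * expR (- (x ^+ 2 / 2)).
Proof.
exists (1 + 2 ^+ k.+1 * (k.+1)`!%:R); split.
  by rewrite addr_ge0// mulr_ge0// exprn_ge0.
move=> x; rewrite normrM (ger0_norm (gauss_fun_ge0 x)).
rewrite /gauss_fun (_ : - x ^+ 2 = x ^+ 2 / 2 *- 2); last by field.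
rewrite mulr2n opprD expRD mulrA ler_wpM2r ?expR_ge0//.
apply: (le_trans (ler_wpM2r (expR_ge0 _) (normr_expr_le k x))).
by rewrite -mulrA -expRD subrr expR0 mulr1.
Qed.

Lemma measurable_gauss_mono k : measurable_fun setT (gauss_mono k).
Proof.
by apply: measurable_funM; [exact: exprn_measurable|exact: measurable_gauss_fun].
Qed.

Lemma integrable_gauss_mono k : mu.-integrable setT (EFin \o gauss_mono k).
Proof.
have [C [C0 hC]] := gauss_mono_bound k.
have i0 : mu.-integrable setT (EFin \o (fun x : R => C * expR (- (x ^+ 2 / 2)))).
  have := @integrable_normal_pdf R 0 1.
  move=> /(integrableZl measurableT (C * (normal_peak 1)^-1)).
  apply: eq_integrable => // x _ /=; rewrite -EFinM; congr EFin.
  rewrite /normal_pdf oner_eq0 /normal_fun -mulrA mulKf.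
    by rewrite subr0 expr1n mulNr.
  by rewrite gt_eqF// normal_peak_gt0// oner_neq0.
apply: le_integrable i0 => //.
  by apply/measurable_EFinP; exact: measurable_gauss_mono.
move=> x _ /=; rewrite lee_fin (le_trans (hC x))//.
exact: ler_norm.
Qed.

Definition gauss_moment k : R := (\int[mu]_x gauss_mono k x)%R.

Lemma gauss_moment0 : gauss_moment 0 = Num.sqrt pi.
Proof.
rewrite /gauss_moment /Rintegral.
under eq_integral do rewrite /gauss_mono expr0 mul1r.
by rewrite integralT_gauss.
Qed.

(** The boundary terms of the integration by parts in [gauss_moment_rec]. *)
Lemma gauss_mono_cvg0 k : (gauss_mono k n%:R @[n --> \oo] --> 0) /\
  (gauss_mono k (- n%:R) @[n --> \oo] --> 0).
Proof.
have [C [C0 hC]] := gauss_mono_bound k.+1.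
have h (x : R) : x != 0 -> `|gauss_mono k x| <= C / `|x|.
  move=> x0; rewrite ler_pdivlMr ?normr_gt0// mulrC -normrM.
  rewrite /gauss_mono mulrA -exprS (le_trans (hC x))// -[leRHS]mulr1.
  rewrite ler_wpM2l// -[leRHS]expR0 ler_expR oppr_le0 divr_ge0// sqr_ge0//.
have c0 : C / (n%:R : R) @[n --> \oo] --> (0:R).
  rewrite -[X in _ --> X](mulr0 C); apply: cvgM; first exact: cvg_cst.
  by apply/gtr0_cvgV0; [near=> n; rewrite ltr0n; near: n; exact: nbhs_infty_gt
    | exact: cvgr_idn].
have c1 : - (C / (n%:R : R)) @[n --> \oo] --> (0:R).
  by rewrite -[X in _ --> X]oppr0; exact: cvgN.
split; apply: (squeeze_cvgr _ c1 c0); near=> n.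
all: have n0 : (0 < n)%N by near: n; exact: nbhs_infty_gt.
all: have := h (n%:R); have := h (- n%:R).
all: by rewrite oppr_eq0 pnatr_eq0 -lt0n n0 normrN (ger0_norm (ler0n _ n)) =>
  /(_ isT) h1 /(_ isT) h2; rewrite -ler_norml.
Unshelve. all: by end_near. Qed.

Lemma is_derive_gauss_mono k (x : R) :
  is_derive x 1 (gauss_mono k) (k%:R * gauss_mono k.-1 x - 2 * gauss_mono k.+1 x).
Proof.
have d1 : is_derive x 1 (fun y : R => y ^+ k) (k%:R * x ^+ k.-1).
  rewrite (_ : (fun y : R => y ^+ k) = (@id R) ^+ k); last first.
    by apply/funext => y; rewrite fctE.
  apply: is_derive_eq.
  by rewrite /GRing.scale/= mulr1 mulr_natl.
have d2 : is_derive x 1 (fun y : R => expR (- y ^+ 2)) (- (2 * x) * gauss_fun x).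
  have d3 : is_derive x 1 (fun y : R => - y ^+ 2) (- (2 * x)).
    rewrite (_ : (fun y : R => - y ^+ 2) = - ((@id R) ^+ 2)); last first.
      by apply/funext => y; rewrite !fctE.
    apply: is_derive_eq.
    by rewrite /GRing.scale/= mulr1 mulr_natl.
  rewrite mulrC.
  exact: (@is_derive1_comp R expR (fun y => - y ^+ 2) x _ _ (is_derive_expR _) d3).
rewrite (_ : gauss_mono k =
    (fun y : R => y ^+ k) * (fun y : R => expR (- y ^+ 2))); last first.
  by apply/funext => y; rewrite fctE.
apply: is_derive_eq.
rewrite /gauss_mono /gauss_fun /GRing.scale /= [x ^+ k.+1]exprS.
move: (expR _) (x ^+ k) (x ^+ k.-1) k%:R => a b c e; ring.
Qed.

(** Integration by parts: the derivative of [x^k exp (- x^2)] has integral 0.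
    For [k = 0] the right-hand side vanishes, whatever the default value of [k.-1]. *)
Lemma gauss_moment_rec k : 2 * gauss_moment k.+1 = k%:R * gauss_moment k.-1.
Proof.
pose f x := k%:R * gauss_mono k.-1 x - 2 * gauss_mono k.+1 x.
have mf : measurable_fun setT f.
  by apply: measurable_funB; apply: measurable_funM => //;
    exact: measurable_gauss_mono.
have If : mu.-integrable setT (EFin \o f).
  have h1 := integrableZl measurableT k%:R (integrable_gauss_mono k.-1).
  have h2 := integrableZl measurableT 2 (integrable_gauss_mono k.+1).
  have := integrableB measurableT h1 h2.
  by apply: eq_integrable => // x _ /=; rewrite -!EFinM -EFinB.
have cf : continuous f.
  have c j : continuous (gauss_mono j).
    by move=> x; apply: cvgM; [exact: exprn_continuous|exact: continuous_gauss_fun].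
  move=> x; apply: cvgB; apply: cvgM; [exact: cvg_cst|exact: c|exact: cvg_cst|exact: c].
suff I0 : (\int[mu]_x f x)%R = 0.
  apply/eqP; rewrite eq_sym -subr_eq0; apply/eqP; rewrite -I0 /gauss_moment.
  rewrite -!RintegralZl//; try exact: integrable_gauss_mono.
  rewrite -RintegralB//.
    have := integrableZl measurableT k%:R (integrable_gauss_mono k.-1).
    by apply: eq_integrable => // x _ /=; rewrite -EFinM.
  have := integrableZl measurableT 2 (integrable_gauss_mono k.+1).
  by apply: eq_integrable => // x _ /=; rewrite -EFinM.
(* The fundamental theorem of calculus applies on bounded intervals; dominated
   convergence then gives the integral over the line. *)
pose fn n x : \bar R := ((f \_ `[- n%:R, n%:R]) x)%:E.
have [] := @dominated_convergence _ _ R mu setT measurableT fn (EFin \o f)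
    (fun x => `|f x|%:E).
- move=> n; apply/measurable_EFinP; apply/measurable_restrict => //.
  exact: measurable_funTS.
- exact/measurable_EFinP.
- apply: aeW => x _; apply: cvg_near_cst; near=> n.
  rewrite /fn patchE mem_set//= in_itv/= -ler_norml.
  by near: n; exact: nbhs_infty_ger.
- by have := integrable_abse If; apply: eq_integrable.
- apply: aeW => x n _; rewrite /fn patchE; case: ifP => _ /=; rewrite lee_fin//.
  by rewrite normr0.
move=> _ _ cI.
have FTC n : (0 < n)%N -> (\int[mu]_x fn n x)%E =
    (gauss_mono k n%:R - gauss_mono k (- n%:R))%:E.
  move=> n0; rewrite EFinB.
  rewrite -(@continuous_FTC2 _ f (gauss_mono k)) //.
  - rewrite [RHS]integral_mkcond /fn; apply: eq_integral => x _.
    by rewrite restrict_EFin.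
  - by rewrite -subr_gt0 opprK addr_gt0 ?ltr0n.
  - exact: continuous_subspaceT.
  - have d x : derivable (gauss_mono k) x 1 by have [] := is_derive_gauss_mono k x.
    have c x : {for x, continuous (gauss_mono k)}.
      exact/differentiable_continuous/derivable1_diffP.
    split=> //; first exact/cvg_at_right_filter/c.
    exact/cvg_at_left_filter/c.
  - by move=> x _; rewrite derive1E; have [_] := is_derive_gauss_mono k x.
have c0 : (gauss_mono k n%:R - gauss_mono k (- n%:R))%:E @[n --> \oo] --> 0%:E.
  have [c1 c2] := gauss_mono_cvg0 k.
  apply: cvg_EFin; first by near=> n.
  by rewrite -[X in _ --> X]subr0; apply: cvgB.
suff : (\int[mu]_x (EFin \o f) x)%E = 0%:E by rewrite /Rintegral => ->.
apply: (cvg_unique _ cI) => //.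
apply: cvg_trans c0; apply: near_eq_cvg; near=> n.
by rewrite /= FTC//; near: n; exact: nbhs_infty_gt.
Unshelve. all: by end_near. Qed.

End RealMoments.

(** * Moments of the complex Gaussian *)

(** The algebra of integration by parts in the plane, over an abstract ring.
    [W k l a b] stands for the Gaussian integral of [x^k y^l z^a \bar z^b] where
    [z = x + i y]; the hypotheses expand one factor [z] or [\bar z], and give the
    integration by parts in [x] and in [y] of the monomials in [x] and [y]. *)
Section MomentRecurrence.
Variables (A : comPzRingType) (i : A) (W : nat -> nat -> nat -> nat -> A).
Hypothesis Wz : forall k l a b, W k l a.+1 b = W k.+1 l a b + i * W k l.+1 a b.
Hypothesis Wzbar : forall k l a b, W k l a b.+1 = W k.+1 l a b - i * W k l.+1 a b.
Hypothesis Wx : forall k l, 2 * W k.+1 l 0 0 = k%:R * W k.-1 l 0 0.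
Hypothesis Wy : forall k l, 2 * W k l.+1 0 0 = l%:R * W k l.-1 0 0.
Hypothesis i2 : i * i = -1.

Fact moment_ibp_x k l a b : 2 * W k.+1 l a b =
  k%:R * W k.-1 l a b + a%:R * W k l a.-1 b + b%:R * W k l a b.-1.
Proof.
elim: a b k l => [|a IHa] b k l.
  elim: b k l => [|b IHb] k l; first by rewrite Wx !mul0r !addr0.
  have := IHb k.+1 l; have := IHb k l.+1.
  rewrite !Wzbar /=; case: b {IHb} => [|b]; case: k => [|k] /=;
  rewrite ?Wzbar ?mul0r ?add0r ?addr0 => h1 h2;
  rewrite mulrBr mulrCA h1 h2 -!natr1; ring.
have := IHa b k.+1 l; have := IHa b k l.+1.
rewrite !Wz /=.
case: a {IHa} => [|a]; case: b => [|b]; case: k => [|k] /=;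
rewrite ?Wz ?mul0r ?add0r ?addr0 => h1 h2;
rewrite mulrDr mulrCA h1 h2 -!natr1; ring.
Qed.

Fact moment_ibp_y k l a b : 2 * W k l.+1 a b =
  l%:R * W k l.-1 a b + i * (a%:R * W k l a.-1 b) - i * (b%:R * W k l a b.-1).
Proof.
elim: a b k l => [|a IHa] b k l.
  elim: b k l => [|b IHb] k l; first by rewrite Wy !mul0r !mulr0 addr0 subr0.
  have := IHb k.+1 l; have := IHb k l.+1.
  rewrite !Wzbar /=; case: b {IHb} => [|b]; case: l => [|l] /=;
  rewrite ?Wzbar ?mul0r ?mulr0 ?add0r ?addr0 => h1 h2;
  rewrite mulrBr mulrCA h1 h2 -!natr1; ring: i2.
have := IHa b k.+1 l; have := IHa b k l.+1.
rewrite !Wz /=.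
case: a {IHa} => [|a]; case: b => [|b]; case: l => [|l] /=;
rewrite ?Wz ?mul0r ?mulr0 ?add0r ?addr0 => h1 h2;
rewrite mulrDr mulrCA h1 h2 -!natr1; ring: i2.
Qed.

(** Integration by parts for the Wirtinger derivations: each of [z], [\bar z]
    acts as the derivation with respect to the other one. *)
Lemma moment_ibp a b :
  (2 * W 0 0 a b.+1 = 2 * (a%:R * W 0 0 a.-1 b)) /\
  (2 * W 0 0 a.+1 b = 2 * (b%:R * W 0 0 a b.-1)).
Proof.
split; [rewrite Wzbar mulrBr|rewrite Wz mulrDr]; rewrite mulrCA moment_ibp_x moment_ibp_y.
  by rewrite !mul0r; ring: i2.
by rewrite !mul0r; ring: i2.
Qed.

End MomentRecurrence.

Section ComplexIntegral.
Variable R : realType.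
Local Notation C := R[i].
Local Notation mu := (@lebesgue_measure R).
Local Notation dA := (@lebesgue_measure R \x @lebesgue_measure R)%E.

Definition integrableC (f : C -> C) : Prop :=
  dA.-integrable setT (fun p => (complex.Re (f (p.1 +i* p.2)))%:E) /\
  dA.-integrable setT (fun p => (complex.Im (f (p.1 +i* p.2)))%:E).

Lemma ReD (x y : C) : complex.Re (x + y) = complex.Re x + complex.Re y.
Proof. by case: x y => [a b] [c e]. Qed.

Lemma ImD (x y : C) : complex.Im (x + y) = complex.Im x + complex.Im y.
Proof. by case: x y => [a b] [c e]. Qed.

Lemma ReM (x y : C) : complex.Re (x * y) =
  complex.Re x * complex.Re y - complex.Im x * complex.Im y.
Proof. by case: x y => [a b] [c e]. Qed.

Lemma ImM (x y : C) : complex.Im (x * y) =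
  complex.Re x * complex.Im y + complex.Im x * complex.Re y.
Proof. by case: x y => [a b] [c e]. Qed.

Lemma integrableCD f g : integrableC f -> integrableC g ->
  integrableC (fun z => f z + g z).
Proof.
move=> [f1 f2] [g1 g2]; split.
  have := integrableD measurableT f1 g1.
  by apply: eq_integrable => // x _ /=; rewrite ReD EFinD.
have := integrableD measurableT f2 g2.
by apply: eq_integrable => // x _ /=; rewrite ImD EFinD.
Qed.

Lemma integralCD f g : integrableC f -> integrableC g ->
  integralC (fun z => f z + g z) = integralC f + integralC g.
Proof.
move=> [f1 f2] [g1 g2]; rewrite /integralC /=; apply/eqP.
rewrite eq_complex /=; apply/andP; split; apply/eqP.
  under eq_Rintegral do rewrite ReD.
  by rewrite RintegralD.
under eq_Rintegral do rewrite ImD.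
by rewrite RintegralD.
Qed.

Lemma integrableCZ c f : integrableC f -> integrableC (fun z => c * f z).
Proof.
move=> [f1 f2]; split.
  have := integrableB measurableT (integrableZl measurableT (complex.Re c) f1)
    (integrableZl measurableT (complex.Im c) f2).
  by apply: eq_integrable => // x _ /=; rewrite ReM EFinB !EFinM.
have := integrableD measurableT (integrableZl measurableT (complex.Re c) f2)
  (integrableZl measurableT (complex.Im c) f1).
by apply: eq_integrable => // x _ /=; rewrite ImM EFinD !EFinM.
Qed.

Lemma integralCZ c f : integrableC f ->
  integralC (fun z => c * f z) = c * integralC f.
Proof.
move=> [f1 f2]; rewrite /integralC /=; apply/eqP.
have h k h : dA.-integrable setT (fun p => (h p)%:E) ->
    dA.-integrable setT (EFin \o (fun p => k * h p)).
  move=> /(integrableZl measurableT k).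
  by apply: eq_integrable => // x _ /=; rewrite EFinM.
rewrite eq_complex ReM ImM /=; apply/andP; split; apply/eqP.
  under eq_Rintegral do rewrite ReM.
  by rewrite RintegralB//; [rewrite !RintegralZl|exact: h|exact: h].
under eq_Rintegral do rewrite ImM.
by rewrite RintegralD//; [rewrite !RintegralZl|exact: h|exact: h].
Qed.

Lemma integrableC0 : integrableC (fun=> 0).
Proof. by split; exact: integrable0. Qed.

Lemma integralC0 : integralC (fun=> 0 : C) = 0.
Proof.
rewrite /integralC /= /Rintegral !integral0 /=. by [].
Qed.

Lemma integrableC_sum (I : Type) (s : seq I) (F : I -> C -> C) :
  (forall i, integrableC (F i)) -> integrableC (fun z => \sum_(i <- s) F i z).
Proof.
move=> h; elim: s => [|i s IH].
  by under eq_fun do rewrite big_nil; exact: integrableC0.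
by under eq_fun do rewrite big_cons; apply: integrableCD.
Qed.

Lemma integralC_sum (I : Type) (s : seq I) (F : I -> C -> C) :
  (forall i, integrableC (F i)) ->
  integralC (fun z => \sum_(i <- s) F i z) = \sum_(i <- s) integralC (F i).
Proof.
move=> h; elim: s => [|i s IH].
  by under eq_fun do rewrite big_nil; rewrite big_nil integralC0.
rewrite big_cons -IH -integralCD//; last exact: integrableC_sum.
by congr integralC; apply/funext => z; rewrite big_cons.
Qed.

Definition gauss_mono2 k l (z : C) : C :=
  (gauss_mono k (complex.Re z) * gauss_mono l (complex.Im z))%:C.

Let mfx k l : measurable_fun setT
  (fun p : R * R => (gauss_mono k p.1 * gauss_mono l p.2)%:E).
Proof.
apply/measurable_EFinP; apply: measurable_funM.
  by apply: measurableT_comp => //; exact: measurable_gauss_mono.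
by apply: measurableT_comp => //; exact: measurable_gauss_mono.
Qed.

Let int_gauss_mono k : (\int[mu]_x (gauss_mono k x)%:E)%E = (gauss_moment R k)%:E.
Proof.
rewrite /gauss_moment /Rintegral fineK//.
by apply: integrable_fin_num => //; exact: integrable_gauss_mono.
Qed.

Let integrable_prod k l : dA.-integrable setT
  (fun p : R * R => (gauss_mono k p.1 * gauss_mono l p.2)%:E).
Proof.
apply/integrable12ltyP; first exact: mfx.
have hI j : mu.-integrable setT (fun x => `|gauss_mono j x|%:E).
  by have := integrable_abse (@integrable_gauss_mono R j); apply: eq_integrable.
have h j : (\int[mu]_x `|gauss_mono j x|%:E)%E \is a fin_num.
  exact: integrable_fin_num.
under eq_integral => x _.
  under eq_integral => y _.
    rewrite /= normrM EFinM. over.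
  rewrite integralZl//.
  over.
rewrite -(fineK (h l)) integralZr//.
by rewrite -(fineK (h k)) -EFinM ltry.
Qed.

Lemma integrableC_gauss_mono2 k l : integrableC (gauss_mono2 k l).
Proof. by split; [exact: integrable_prod|exact: integrable0]. Qed.

Lemma integralC_gauss_mono2 k l :
  integralC (gauss_mono2 k l) = (gauss_moment R k * gauss_moment R l)%:C.
Proof.
rewrite /integralC /gauss_mono2 /= /Rintegral integral0 /=; congr (_ +i* _).
rewrite -[LHS]/(fine (\int[dA]_p (gauss_mono k p.1 * gauss_mono l p.2)%:E)%E).
rewrite -integral12_prod_meas1//=.
under eq_integral => x _.
  rewrite /fubini_F /=.
  under eq_integral do rewrite EFinM.
  rewrite integralZl//; last exact: integrable_gauss_mono.
  rewrite int_gauss_mono.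
  over.
rewrite integralZr//; last exact: integrable_gauss_mono.
by rewrite int_gauss_mono.
Qed.

Fact split_mul (A : comPzRingType) (i g x y u w : A) :
  g * u * ((x + i * y) * w) = x * g * u * w + i * (y * g * u * w).
Proof. ring. Qed.

(** The function [x^k y^l z^a \bar z^b exp (- |z|^2)] of [z = x + i y].  The
    powers of [x] and [y] are kept apart so that [z] and [\bar z] can be expanded
    one factor at a time, down to products of one-dimensional Gaussians. *)
Definition gauss_mono4 k l a b (z : C) : C := gauss_mono2 k l z * z ^+ a * conjc z ^+ b.

Lemma gauss_mono2_mulx k l z :
  (complex.Re z)%:C * gauss_mono2 k l z = gauss_mono2 k.+1 l z.
Proof. by rewrite /gauss_mono2 /gauss_mono -rmorphM exprS !mulrA. Qed.

Lemma gauss_mono2_muly k l z :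
  (complex.Im z)%:C * gauss_mono2 k l z = gauss_mono2 k l.+1 z.
Proof.
by rewrite /gauss_mono2 /gauss_mono -rmorphM exprS mulrCA !mulrA.
Qed.

Lemma gauss_mono4_z k l a b : gauss_mono4 k l a.+1 b =
  fun z => gauss_mono4 k.+1 l a b z + 'i%C * gauss_mono4 k l.+1 a b z.
Proof.
apply/funext => z; rewrite /gauss_mono4 -gauss_mono2_mulx -gauss_mono2_muly exprS.
by rewrite {2}(complexE z) -split_mul !mulrA [X in X * _ = _]mulrAC.
Qed.

Lemma gauss_mono4_zbar k l a b : gauss_mono4 k l a b.+1 =
  fun z => gauss_mono4 k.+1 l a b z + - 'i%C * gauss_mono4 k l.+1 a b z.
Proof.
apply/funext => z; rewrite /gauss_mono4 -gauss_mono2_mulx -gauss_mono2_muly exprS.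
rewrite (_ : conjc z = (complex.Re z)%:C - 'i%C * (complex.Im z)%:C); last first.
  by case: z => x y; simpc.
by rewrite -mulNr; exact: split_mul.
Qed.

Lemma integrableC_gauss_mono4 k l a b : integrableC (gauss_mono4 k l a b).
Proof.
elim: a k l => [|a IHa] k l; last first.
  by rewrite gauss_mono4_z; apply: integrableCD => //; exact: integrableCZ.
elim: b k l => [|b IHb] k l; last first.
  by rewrite gauss_mono4_zbar; apply: integrableCD => //; exact: integrableCZ.
rewrite (_ : gauss_mono4 _ _ _ _ = gauss_mono2 k l).
  exact: integrableC_gauss_mono2.
by apply/funext => z; rewrite /gauss_mono4 !mulr1.
Qed.

Definition gauss_int4 k l a b := integralC (gauss_mono4 k l a b).

Lemma gauss_int4_00 k l :
  gauss_int4 k l 0 0 = (gauss_moment R k * gauss_moment R l)%:C.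
Proof.
rewrite -integralC_gauss_mono2; congr integralC.
by apply/funext => z; rewrite /gauss_mono4 !mulr1.
Qed.

Lemma gauss_int4_z k l a b : gauss_int4 k l a.+1 b =
  gauss_int4 k.+1 l a b + 'i%C * gauss_int4 k l.+1 a b.
Proof.
rewrite /gauss_int4 gauss_mono4_z integralCD ?integralCZ//;
  by [exact: integrableC_gauss_mono4 | exact/integrableCZ/integrableC_gauss_mono4].
Qed.

Lemma gauss_int4_zbar k l a b : gauss_int4 k l a b.+1 =
  gauss_int4 k.+1 l a b - 'i%C * gauss_int4 k l.+1 a b.
Proof.
rewrite /gauss_int4 gauss_mono4_zbar integralCD ?integralCZ ?mulNr//;
  by [exact: integrableC_gauss_mono4 | exact/integrableCZ/integrableC_gauss_mono4].
Qed.

Lemma gauss_int4_step a b :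
  (gauss_int4 0 0 a b.+1 = a%:R * gauss_int4 0 0 a.-1 b) /\
  (gauss_int4 0 0 a.+1 b = b%:R * gauss_int4 0 0 a b.-1).
Proof.
have two_inj (x y : C) : 2 * x = 2 * y -> x = y.
  by apply/mulfI; rewrite pnatr_eq0.
have mc k l : 2 * gauss_int4 k.+1 l 0 0 = k%:R * gauss_int4 k.-1 l 0 0.
  rewrite !gauss_int4_00 -!(rmorph_nat (@real_complex R)) -!rmorphM.
  by rewrite !mulrA gauss_moment_rec.
have mc' k l : 2 * gauss_int4 k l.+1 0 0 = l%:R * gauss_int4 k l.-1 0 0.
  rewrite !gauss_int4_00 -!(rmorph_nat (@real_complex R)) -!rmorphM.
  by rewrite mulrCA gauss_moment_rec mulrCA.
have i2 : 'i%C * 'i%C = -1 :> C by rewrite -expr2 sqr_i.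
by split; apply: two_inj;
  have [] := moment_ibp gauss_int4_z gauss_int4_zbar mc mc' i2 a b.
Qed.

(** The monomials [z^a] are orthogonal, with squared norm [pi * a!]: one factor
    [\bar z] is removed by differentiating [z^a], until a power remains alone. *)
Lemma gauss_intE a b :
  gauss_int4 0 0 a b = if a == b then (pi * a`!%:R)%:C else 0.
Proof.
elim: b a => [|b IHb] [|a].
- rewrite gauss_int4_00 gauss_moment0 -expr2 sqr_sqrtr ?pi_ge0// mulr1//.
- by have [_ ->] := gauss_int4_step a 0; rewrite mul0r.
- by have [-> _] := gauss_int4_step 0 b; rewrite mul0r.
have [-> _] := gauss_int4_step a.+1 b; rewrite /= IHb eqSS.
case: eqP => [->|_]; last by rewrite mulr0.
by rewrite factS natrM mulrCA [RHS]rmorphM /= rmorph_nat.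
Qed.

End ComplexIntegral.

(** * Gaussian integration as a sesquilinear form on polynomials *)

Section GaussPairing.
Variable R : realType.
Local Notation C := R[i].

(** Iterated integrals of products factor.  The sum is part of the statement
    because the induction on [r] needs the integrals for all the terms at once. *)
Lemma iter_integralC_prod (I : Type) (s : seq I) (r : nat) (c : I -> C)
    (a b : I -> nat -> nat) :
  iter_integralC (fun t : r.-tuple C => \sum_(i <- s) c i *
    \prod_(j < r) gauss_mono4 0 0 (a i j) (b i j) (tnth t j)) =
  \sum_(i <- s) c i * \prod_(j < r) gauss_int4 R 0 0 (a i j) (b i j).
Proof.
elim: r c a b => [|r IHr] c a b /=.
  by apply: eq_bigr => i _; rewrite !big_ord0.
transitivity (integralC (fun z => \sum_(i <- s)
    (c i * \prod_(j < r) gauss_int4 R 0 0 (a i j.+1) (b i j.+1)) *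
      gauss_mono4 0 0 (a i 0) (b i 0) z)).
  congr integralC; apply/funext => z.
  transitivity (\sum_(i <- s) (c i * gauss_mono4 0 0 (a i 0) (b i 0) z) *
      \prod_(j < r) gauss_int4 R 0 0 (a i j.+1) (b i j.+1)).
    rewrite -(IHr _ (fun i j => a i j.+1) (fun i j => b i j.+1)).
    congr iter_integralC; apply/funext => t; apply: eq_bigr => i _.
    rewrite big_ord_recl mulrA tnth0; congr (_ * _).
    by apply: eq_bigr => j _; rewrite tnthS.
  by apply: eq_bigr => i _; rewrite mulrAC.
rewrite integralC_sum => [|i]; last exact/integrableCZ/integrableC_gauss_mono4.
apply: eq_bigr => i _; rewrite integralCZ; last exact: integrableC_gauss_mono4.
by rewrite big_ord_recl mulrA mulrAC.
Qed.

Lemma gauss_weightE r (t : r.-tuple C) :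
  gauss_weight t = \prod_(j < r) gauss_mono2 0 0 (tnth t j).
Proof.
rewrite /gauss_weight rmorph_prod; apply: eq_bigr => j _.
rewrite /gauss_mono2 /gauss_mono !expr0 !mul1r /gauss_fun -expRD.
case: (tnth t j) => x y /=; rewrite sqr_sqrtr ?addr_ge0 ?sqr_ge0//.
by rewrite opprD.
Qed.

(** The Gaussian inner product divided by [pi ^+ r]: monomials are orthogonal
    and the squared norm of [t^m] is the product of the factorials [(m j)!]. *)
Definition pairing r (p q : {mpoly C[r]}) : C :=
  \sum_(m <- msupp p) p@_m * conjc q@_m * (\prod_(j < r) (m j)`!)%:R.

(** After expansion, orthogonality in each variable leaves the pairs of equal
    monomials of [p] and [q]. *)
Lemma iter_integralC_pairing r (p q : {mpoly C[r]}) :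
  iter_integralC (fun t : r.-tuple C =>
    p.@[tnth t] * Num.conj q.@[tnth t] * gauss_weight t) =
  (pi ^+ r)%:C * pairing p q.
Proof.
pose I := ('X_{1..r} * 'X_{1..r})%type.
pose s : seq I := [seq (m1, m2) | m1 <- msupp p, m2 <- msupp q].
transitivity (iter_integralC (fun t : r.-tuple C => \sum_(i <- s)
   (p@_(i.1) * conjc q@_(i.2)) * \prod_(j < r)
     gauss_mono4 0 0 (nth 0%N i.1 j) (nth 0%N i.2 j) (tnth t j))).
  congr iter_integralC; apply/funext => t.
  rewrite big_allpairs_dep /= !mevalE.
  rewrite -[Num.conj _]/(conjc _) rmorph_sum big_distrlr /= mulr_suml.
  apply: eq_bigr => m1 _; rewrite mulr_suml; apply: eq_bigr => m2 _.
  rewrite rmorphM /= rmorph_prod gauss_weightE mulrACA -!mulrA; congr (_ * (_ * _)).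
  rewrite -!big_split /=; apply: eq_bigr => j _.
  by rewrite /gauss_mono4 rmorphXn /= -!mnm_nth mulrA mulrC mulrA.
rewrite (iter_integralC_prod s r (fun i => p@_(i.1) * conjc q@_(i.2))
  (fun i => nth 0%N i.1) (fun i => nth 0%N i.2)) big_allpairs_dep /= mulr_sumr.
apply: eq_bigr => m1 hm1.
under eq_bigr => m2 _.
  under eq_bigr do rewrite gauss_intE -!mnm_nth.
  over.
have [hm2|hm2] := boolP (m1 \in msupp q); last first.
  rewrite (memN_msupp_eq0 hm2) conjc0 !(mulr0, mul0r) big_seq big1 // => m2 hm.
  have /eqP/mnmP hne : m1 != m2 by apply: contraNneq hm2 => ->.
  have /existsP[j /negPf hj] : [exists j, m1 j != m2 j].
    by apply: contra_notT hne => /existsPn h j; apply/eqP; rewrite -[_ == _]negbK h.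
  by rewrite (bigD1 j) //= hj mul0r mulr0.
rewrite (bigD1_seq m1) //= [X in _ + X]big1 ?addr0 => [|m2 hm].
  rewrite mulrCA; congr (_ * _); under eq_bigr do rewrite eqxx.
  rewrite -rmorph_prod -(rmorph_nat (@real_complex R)) -rmorphM /=; congr (_ %:C).
  by rewrite big_split /= prodr_const card_ord natr_prod.
have /eqP/mnmP hne : m1 != m2 by rewrite eq_sym.
have /existsP[j /negPf hj] : [exists j, m1 j != m2 j].
  by apply: contra_notT hne => /existsPn h j; apply/eqP; rewrite -[_ == _]negbK h.
by rewrite (bigD1 j) //= hj mul0r mulr0.
Qed.

End GaussPairing.

Local Close Scope classical_set_scope.

(** * Formal power series *)

Section FpsTheory.
Variable A : comNzRingType.
Implicit Types f g : fps A.

Lemma coef_fpsD f g k : fps_coef (f + g) k = fps_coef f k + fps_coef g k.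
Proof. by []. Qed.

Lemma coef_fpsM f g k :
  fps_coef (f * g) k = \sum_(i < k.+1) fps_coef f i * fps_coef g (k - i).
Proof. by []. Qed.

Lemma coef_fps0 k : fps_coef (0 : fps A) k = 0.
Proof. by rewrite /=; case: ifP. Qed.

Lemma coef_fps1 k : fps_coef (1 : fps A) k = (k == 0%N)%:R.
Proof. by rewrite /=; case: ifP. Qed.

Lemma coef_fpsMn f n k : fps_coef (f *+ n) k = fps_coef f k *+ n.
Proof. by elim: n => [|n IHn]; rewrite ?mulr0n ?coef_fps0 // !mulrS coef_fpsD IHn. Qed.

Lemma coef_fps_sum (I : Type) (s : seq I) (P : pred I) (F : I -> fps A) k :
  fps_coef (\sum_(i <- s | P i) F i) k = \sum_(i <- s | P i) fps_coef (F i) k.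
Proof. exact: (big_morph (fun f => fps_coef f k) (fun f g => erefl) (coef_fps0 k)). Qed.

Lemma coef_fpsCM c f k : fps_coef (fpsC c * f) k = c * fps_coef f k.
Proof.
rewrite coef_fpsM big_ord_recl /= subn0 big1 ?addr0 // => i _.
by rewrite mul0r.
Qed.

Lemma coef_fpsXnM n f k :
  fps_coef (fpsX ^+ n * f) k = if (n <= k)%N then fps_coef f (k - n) else 0.
Proof.
elim: n f k => [|n IHn] f k; first by rewrite expr0 mul1r subn0.
rewrite exprSr -mulrA IHn; case: (ltngtP n k) => [lt_nk|//|->]; last first.
  by rewrite subnn coef_fpsM big_ord1 /= mul0r.
rewrite coef_fpsM.
rewrite (_ : (k - n)%N = (k - n.+1).+1); last by rewrite subnSK.
rewrite big_ord_recl /= mul0r add0r big_ord_recl /= mul1r subSS subn0.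
by rewrite big1 ?addr0 // => i _; rewrite mul0r.
Qed.

Lemma coef_fpsXn n k : fps_coef (fpsX ^+ n : fps A) k = (k == n)%:R.
Proof.
rewrite -[fpsX ^+ n]mulr1 coef_fpsXnM coef_fps1 subn_eq0.
by rewrite [k == n]eqn_leq andbC; case: (n <= k)%N.
Qed.

Lemma coef_fps_expr_eq0 f n k :
  fps_coef f 0 = 0 -> (k < n)%N -> fps_coef (f ^+ n) k = 0.
Proof.
move=> f0; elim: n k => // n IHn k lt_kn.
rewrite exprS coef_fpsM big_ord_recl f0 mul0r add0r big1 // => i _.
rewrite IHn ?mulr0 // lift0; have := ltn_ord i; move: lt_kn; lia.
Qed.

(** The map [D] is abstract since the rule serves both for the partial derivations
    of polynomials and for the derivation of series. *)
Lemma leibniz_prod (D : A -> A) (D1 : D 1 = 0)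
    (DM : forall x y, D (x * y) = D x * y + x * D y) (I : finType) (F : I -> A) :
  D (\prod_i F i) = \sum_i \prod_k (if k == i then D (F k) else F k).
Proof.
suff h (s : seq I) : uniq s -> D (\prod_(i <- s) F i) =
    \sum_(i <- s) \prod_(k <- s) (if k == i then D (F k) else F k).
  exact/h/index_enum_uniq.
elim: s => [|i s IHs] /=; first by rewrite !big_nil.
move=> /andP[is_ us]; rewrite !big_cons DM eqxx IHs // mulr_sumr; congr (_ + _).
  congr (_ * _); apply: eq_big_seq => k ks; case: eqP => // ki.
  by rewrite -ki ks in is_.
apply: eq_big_seq => k ks; rewrite big_cons; case: eqP => // ik.
by rewrite ik ks in is_.
Qed.

Definition fps_deriv f : fps A := \fps_(k) (fps_coef f k.+1 *+ k.+1).

Lemma fps_derivM f g : fps_deriv (f * g) = fps_deriv f * g + f * fps_deriv g.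
Proof.
apply/fpsP => k; rewrite coef_fpsD !coef_fpsM.
rewrite -[LHS]/((\sum_(i < k.+2) fps_coef f i * fps_coef g (k.+1 - i)) *+ k.+1).
transitivity (\sum_(i < k.+2) fps_coef f i * fps_coef g (k.+1 - i) *+ i +
   \sum_(i < k.+2) fps_coef f i * fps_coef g (k.+1 - i) *+ (k.+1 - i)).
  rewrite -big_split /= -sumrMnl; apply: eq_bigr => i _.
  by rewrite -mulrnDr subnKC // -ltnS.
congr (_ + _).
  rewrite big_ord_recl mulr0n add0r; apply: eq_bigr => i _.
  by rewrite /= /bump /= add1n subSS mulrnAl.
rewrite big_ord_recr /= subnn mulr0n addr0; apply: eq_bigr => i _.
by rewrite subSn ?mulrnAr // -ltnS.
Qed.

Lemma fps_deriv1 : fps_deriv 1 = 0.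
Proof.
by apply/fpsP => k; rewrite coef_fps0 /= mul0rn.
Qed.

End FpsTheory.

Section FpsMap.
Variables (A B : comNzRingType) (h : {rmorphism A -> B}).

Lemma fps_mapM f g : fps_map h (f * g) = fps_map h f * fps_map h g.
Proof.
apply/fpsP => k; rewrite /= rmorph_sum; apply: eq_bigr => i _.
by rewrite rmorphM.
Qed.

Lemma fps_mapX : fps_map h fpsX = fpsX.
Proof. by apply/fpsP => k; rewrite /= rmorph_nat. Qed.

Lemma fps_mapC c : fps_map h (fpsC c) = fpsC (h c).
Proof. by apply/fpsP => k; rewrite /=; case: ifP; rewrite ?rmorph0. Qed.

Lemma fps_map_exp f n : fps_map h (f ^+ n) = fps_map h f ^+ n.
Proof.
elim: n => [|n IHn]; last by rewrite !exprS fps_mapM IHn.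
by rewrite !expr0; apply/fpsP => k; rewrite [RHS]coef_fps1 /=;
  case: ifP; rewrite ?rmorph1 ?rmorph0.
Qed.

Lemma fps_map_sum (I : Type) (s : seq I) (P : pred I) (F : I -> fps A) :
  fps_map h (\sum_(i <- s | P i) F i) = \sum_(i <- s | P i) fps_map h (F i).
Proof.
apply/fpsP => k; rewrite coef_fps_sum -[LHS]/(h _) coef_fps_sum rmorph_sum.
by [].
Qed.

End FpsMap.

(** * The adjoint of multiplication by a variable *)

Section Pairing.
Variables (R : realType) (r : nat).
Local Notation C := R[i].
Implicit Types p q : {mpoly C[r]}.

(** The sum defining [pairing] may range over any larger support, hence over a
    support common to several polynomials. *)
Lemma pairing_suppE (s : seq 'X_{1..r}) p q :
  uniq s -> {subset msupp p <= s} ->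
  pairing p q = \sum_(m <- s) p@_m * conjc q@_m * (\prod_(j < r) (m j)`!)%:R.
Proof.
move=> us sub; rewrite [RHS](bigID (fun m => m \in msupp p)) /=.
rewrite [X in _ + X]big1 ?addr0 => [|m /memN_msupp_eq0 ->]; last by rewrite !mul0r.
rewrite -big_filter; apply: perm_big; apply: uniq_perm; rewrite ?filter_uniq //.
by move=> m; rewrite mem_filter andb_idr // => /sub.
Qed.

Lemma pairingDl p1 p2 q : pairing (p1 + p2) q = pairing p1 q + pairing p2 q.
Proof.
pose s := undup (msupp (p1 + p2) ++ msupp p1 ++ msupp p2).
have us : uniq s := undup_uniq _.
rewrite !(pairing_suppE q us); try by
  move=> m hm; rewrite mem_undup !mem_cat hm ?orbT.
rewrite -big_split; apply: eq_bigr => m _ /=.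
by rewrite mcoeffD !mulrDl.
Qed.

Lemma pairingZl c p q : pairing (c *: p) q = c * pairing p q.
Proof.
pose s := undup (msupp (c *: p) ++ msupp p).
have us : uniq s := undup_uniq _.
rewrite !(pairing_suppE q us); try by
  move=> m hm; rewrite mem_undup !mem_cat hm ?orbT.
rewrite mulr_sumr; apply: eq_bigr => m _ /=.
by rewrite mcoeffZ !mulrA.
Qed.

Lemma pairing0l q : pairing (0 : {mpoly C[r]}) q = 0.
Proof. by rewrite -(scale0r 0) pairingZl mul0r. Qed.

Lemma pairing_suml (I : Type) (s : seq I) (P : pred I) (F : I -> {mpoly C[r]}) q :
  pairing (\sum_(i <- s | P i) F i) q = \sum_(i <- s | P i) pairing (F i) q.
Proof.
exact: (big_morph (fun p => pairing p q) (fun p1 p2 => pairingDl p1 p2 q) (pairing0l q)).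
Qed.

Lemma pairingDr p q1 q2 : pairing p (q1 + q2) = pairing p q1 + pairing p q2.
Proof.
rewrite -big_split; apply: eq_bigr => m _ /=.
by rewrite mcoeffD rmorphD mulrDr mulrDl.
Qed.

Lemma pairingZr c p q : pairing p (c *: q) = conjc c * pairing p q.
Proof.
rewrite mulr_sumr; apply: eq_bigr => m _ /=.
by rewrite mcoeffZ rmorphM /= [p@_m * _]mulrCA !mulrA.
Qed.

Lemma pairing0r p : pairing p 0 = 0.
Proof. by rewrite -(scale0r 0) pairingZr conjc0 mul0r. Qed.

Lemma pairing_sumr (I : Type) (s : seq I) (P : pred I) p (F : I -> {mpoly C[r]}) :
  pairing p (\sum_(i <- s | P i) F i) = \sum_(i <- s | P i) pairing p (F i).
Proof.
exact: (big_morph (pairing p) (fun q1 q2 => pairingDr p q1 q2) (pairing0r p)).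
Qed.

Lemma pairing_monomial (m k : 'X_{1..r}) :
  pairing ('X_[m] : {mpoly C[r]}) 'X_[k] =
  if m == k then (\prod_(j < r) (m j)`!)%:R else 0.
Proof.
rewrite /pairing msuppX big_seq1 !mcoeffX eqxx mul1r rmorph_nat eq_sym.
by case: eqP; rewrite ?mul1r ?mul0r.
Qed.

(** On monomials both sides are 0 unless the exponents differ by one at [j], and
    then [(m j)! = m j * (m j - 1)!]. *)
Lemma pairing_mulX j p q : pairing p ('X_j * q) = pairing p^`M(j) q.
Proof.
elim/mpolyind: p => [|c m p _ _ IHp]; first by rewrite mderiv0 !pairing0l.
rewrite mderivD mderivZ !pairingDl !pairingZl {}IHp; congr (_ * _ + _) => {p c}.
elim/mpolyind: q => [|c k q _ _ IHq]; first by rewrite mulr0 !pairing0r.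
rewrite mulrDr !pairingDr -scalerAr !pairingZr {}IHq; congr (_ * _ + _) => {q c}.
rewrite -mpolyXD mderivX pairingZl !pairing_monomial.
case: (posnP (m j)) => [mj0|mj0].
  rewrite mj0 mul0r; case: eqP => // mE; move: mj0.
  by rewrite mE mnmDE mnm1E eqxx.
have Um : (U_(j) <= m)%MM.
  by apply/mnm_lepP => i; rewrite mnm1E; case: eqP => // <-.
have -> : (m == U_(j) + k)%MM = (m - U_(j) == k)%MM.
  apply/eqP/eqP => [->|<-]; last by rewrite addmC submK.
  by rewrite addmC addmK.
case: eqP => _; last by rewrite mulr0.
rewrite -natrM (bigD1 j) //= [in RHS](bigD1 j) //=; congr (_%:R).
rewrite mnmBE mnm1E eqxx subn1 mulnA -[X in (X * (X.-1)`!)%N](prednK mj0).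
rewrite /= -factS prednK //; congr muln; apply: eq_bigr => i ij.
by rewrite mnmBE mnm1E eq_sym (negPf ij) subn0.
Qed.

End Pairing.

(** * The complete symmetric functions as polynomials in the power sums *)

Section CompleteSymmetric.
Variables (R : realType) (r : nat).
Local Notation C := R[i].
Local Notation P := {mpoly C[r]}.

Definition power_sum_series : fps P := \sum_(j < r) fpsC 'X_j * fpsX ^+ j.+1.

(** The coefficient [h_k] of [z^k] in [exp (\sum_j t_j z^j)], as a polynomial
    in the [t_j].  The terms with [n > k] of the exponential do not contribute. *)
Definition hpoly (k : nat) : P :=
  \sum_(n < k.+1) (n`!%:R)^-1 *: fps_coef (power_sum_series ^+ n) k.

Lemma coef_power_sum_series0 : fps_coef power_sum_series 0 = 0.
Proof.
rewrite coef_fps_sum big1 // => j _.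
by rewrite coef_fpsCM coef_fpsXn mulr0.
Qed.

Lemma meval_hpoly (t : r.-tuple C) k : (hpoly k).@[tnth t] = hcoef t k.
Proof.
rewrite /hcoef /fps_exp /fps_sum raddf_sum; apply: eq_bigr => n _.
rewrite coef_fpsCM /= mevalZ; congr (_ * _).
rewrite -[LHS]/(fps_coef (fps_map (meval (tnth t)) (power_sum_series ^+ n)) k).
rewrite fps_map_exp fps_map_sum; congr (fps_coef (_ ^+ _) _).
apply: eq_bigr => j _.
by rewrite fps_mapM fps_mapC fps_map_exp fps_mapX /= mevalXU.
Qed.

Lemma mderiv_power_sum_series (j : 'I_r) n :
  fps_map (mderiv j) (power_sum_series ^+ n.+1) =
  (fpsX ^+ j.+1 * power_sum_series ^+ n) *+ n.+1.
Proof.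
have DM (f g : fps P) : fps_map (mderiv j) (f * g) =
    fps_map (mderiv j) f * g + f * fps_map (mderiv j) g.
  apply/fpsP => k; rewrite coef_fpsD !coef_fpsM /= raddf_sum -big_split.
  by apply: eq_bigr => i _; rewrite /= mderivM.
have D1 : fps_map (mderiv j) power_sum_series = fpsX ^+ j.+1.
  apply/fpsP => k; rewrite -[LHS]/(_ ^`M(j))%R coef_fps_sum raddf_sum.
  transitivity (\sum_(i < r | i == j) (k == i.+1)%:R : P); last first.
    by rewrite big_pred1_eq coef_fpsXn.
  rewrite [RHS]big_mkcond; apply: eq_bigr => i _.
  rewrite coef_fpsCM coef_fpsXn mulr_natr raddfMn /= mderivX mnm1E.
  case: eqP => [->|_]; last by rewrite scale0r mul0rn.
  have -> : (U_(j) - U_(j))%MM = 0%MM by apply/mnmP => l; rewrite mnmBE subnn mnm0E.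
  by rewrite scale1r mpolyX0.
elim: n => [|n IHn]; first by rewrite expr1 expr0 mulr1 mulr1n.
rewrite exprS DM D1 {}IHn [RHS]mulrS; congr (_ + _).
by rewrite mulrnAr mulrCA -exprS.
Qed.

Definition hpolyz (m : int) : P := if m is Posz k then hpoly k else 0.

Lemma hpolyz_neg m : m < 0 -> hpolyz m = 0.
Proof. by case: m. Qed.

(** The [t_j]-derivative of [exp (\sum_j t_j z^j)] is its product by [z^j]; the
    index of a variable is shifted by one, as ['X_j] is the variable [t_(j+1)]. *)
Lemma mderiv_hpolyz (j : 'I_r) (m : int) :
  (hpolyz m)^`M(j) = hpolyz (m - j.+1%:Z).
Proof.
case: m => [k|k]; last by rewrite mderiv0 [RHS]hpolyz_neg //; lia.
rewrite -[hpolyz k]/(hpoly k) /hpoly big_ord_recl mderivD mderivZ expr0 coef_fps1.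
rewrite raddfMn /= mderivC mul0rn scaler0 add0r raddf_sum.
transitivity (\sum_(n < k) (n`!%:R)^-1 *:
    fps_coef (fpsX ^+ j.+1 * power_sum_series ^+ n) k : P).
  apply: eq_bigr => n _; rewrite /= mderivZ /bump leq0n add1n.
  rewrite -[mderiv j _]/(fps_coef (fps_map (mderiv j) (power_sum_series ^+ n.+1)) k).
  rewrite mderiv_power_sum_series.
  rewrite coef_fpsMn -[_ *+ n.+1]scaler_nat scalerA factS natrM invfM mulrAC.
  by rewrite mulVf ?mul1r // pnatr_eq0.
under eq_bigr do rewrite coef_fpsXnM.
case: (leqP j.+1 k) => [le_jk|lt_kj]; last first.
  rewrite big1 => [|n _]; last by rewrite scaler0.
  by rewrite [RHS]hpolyz_neg //; lia.
have -> : k%:Z - j.+1%:Z = (k - j.+1)%N by lia.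
rewrite /= /hpoly (big_ord_widen _ (fun n => (n`!%:R)^-1 *:
  fps_coef (power_sum_series ^+ n) (k - j.+1)) (_ : (k - j.+1).+1 <= k)%N); last by lia.
rewrite [RHS]big_mkcond; apply: eq_bigr => n _; case: ltnP => // lt_n.
by rewrite coef_fps_expr_eq0 ?scaler0 // coef_power_sum_series0.
Qed.

End CompleteSymmetric.

(** * The coefficients of the Toeplitz determinant *)

Section Shift.
Variable d : nat.
Definition add_at (m : {ffun 'I_d -> int}) (i : 'I_d) (l : int) : {ffun 'I_d -> int} :=
  [ffun k => m k + (k == i)%:Z * l].
End Shift.

Section HProducts.
Variables (R : realType) (r d : nat).
Local Notation C := R[i].
Local Notation P := {mpoly C[r]}.
Local Notation vec := {ffun 'I_d -> int}.

Definition hprod (m : vec) : P := \prod_(i < d) hpolyz R r (m i).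

Lemma prod_add_at (A : comNzRingType) (F G : int -> A) (m : vec) (i : 'I_d) l :
  (forall k, G k = F (k + l)) ->
  \prod_k (if k == i then G (m k) else F (m k)) = \prod_k F (add_at m i l k).
Proof.
move=> GF; apply: eq_bigr => k _; rewrite ffunE.
by case: eqP => _; rewrite ?GF ?mul1r ?mul0r ?addr0.
Qed.

Lemma mderiv_hprod (j : 'I_r) m :
  (hprod m)^`M(j) = \sum_(i < d) hprod (add_at m i (- j.+1%:Z)).
Proof.
rewrite /hprod (leibniz_prod (D := mderiv j)); last first.
- by move=> x y; rewrite mderivM.
- by rewrite -mpolyC1 mderivC.
by apply: eq_bigr => i _;
  exact: (@prod_add_at _ (@hpolyz R r) (fun k => (hpolyz R r k)^`M(j)) m i _
    (mderiv_hpolyz R j)).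
Qed.

Lemma pairing_hprod_mulX (j : 'I_r) m q :
  pairing (hprod m) ('X_j * q) =
  \sum_(i < d) pairing (hprod (add_at m i (- j.+1%:Z))) q.
Proof. by rewrite pairing_mulX mderiv_hprod pairing_suml. Qed.

(** Pairing with 1 is evaluation at [t = 0], where [exp (\sum_j t_j z^j)] is 1. *)
Lemma pairing_hprod1 m : pairing (hprod m) 1 = (m == [ffun=> 0])%:R.
Proof.
have e0 (p : P) : pairing p 1 = p.@[fun=> 0].
  rewrite mevalE /pairing; apply: eq_bigr => k _.
  rewrite -mpolyC1 mcoeffC mul1r rmorph_nat; case: eqP => [->|k0].
    rewrite mulr1 [X in _ * X%:R]big1 => [|i _]; last by rewrite mnm0E fact0.
    by rewrite mulr1 big1 ?mulr1 // => i _; rewrite mnm0E expr0.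
  rewrite mulr0 mul0r; have /existsP[i hi] : [exists i, k i != 0%N].
    apply: contra_notT k0 => /existsPn h; apply/mnmP => i; rewrite mnm0E.
    by apply/eqP; rewrite -[_ == _]negbK h.
  by rewrite (bigD1 i) //= expr0n (negPf hi) mul0r mulr0.
have h0 (k : int) : (hpolyz R r k).@[fun=> 0] = (k == 0)%:R.
  case: k => k; last by rewrite meval0.
  have -> : (hpolyz R r k).@[fun=> 0] = hcoef [tuple of nseq r (0 : C)] k.
    by rewrite -meval_hpoly; apply: meval_eq => i; rewrite (tnth_nth 0) nth_nseq if_same.
  rewrite /hcoef; have -> : \sum_(j < r) fpsC (tnth [tuple of nseq r (0 : C)] j) *
      fpsX ^+ j.+1 = 0 :> fps C.
    apply: big1 => j _; apply/fpsP => l.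
    by rewrite coef_fpsCM (tnth_nth 0) nth_nseq if_same mul0r coef_fps0.
  rewrite -[LHS]/(\sum_(n < k.+1) fps_coef (fpsC (n`!%:R)^-1 * 0 ^+ n : fps C) k).
  rewrite big_ord_recl big1 ?addr0 => [|n _].
    by rewrite coef_fpsCM expr0 coef_fps1 fact0 invr1 mul1r.
  by rewrite coef_fpsCM lift0 expr0n [fps_coef _ k]coef_fps0 mulr0.
rewrite e0 rmorph_prod /=.
under eq_bigr do rewrite h0.
case: eqP => [->|m0]; first by rewrite big1 // => i _; rewrite ffunE.
have /existsP[i /negPf hi] : [exists i, m i != 0].
  apply: contra_notT m0 => /existsPn h; apply/ffunP => i; rewrite ffunE.
  by apply/eqP; rewrite -[_ == _]negbK h.
by rewrite (bigD1 i) //= hi mul0r.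
Qed.

(** The coefficient of [v^k] in a product of Toeplitz entries, times [k!], as a
    polynomial in [t]: see [coef_prod_phi]. *)
Fixpoint hwalk (k : nat) (m : vec) : P :=
  if k is k'.+1 then \sum_(i < d) hwalk k' (add_at m i 1) else hprod m.

(** In [exp (v / z + \sum_j t_j z^j)], derivation with respect to [v] divides by
    [z], which raises the index of the coefficient. *)
Lemma phiS_deriv (m : int) (t : r.-tuple C) : fps_deriv (phi m t) = phi (m + 1) t.
Proof.
apply/fpsP => k /=; rewrite (_ : k.+1%:Z + m = k%:Z + (m + 1)); last by lia.
case: (_ + _) => [q|q]; last by rewrite mul0rn.
by rewrite -[LHS]mulr_natr -mulrA factS natrM invfM mulrAC mulVf ?mul1r // pnatr_eq0.
Qed.

(** The coefficient of [v^k], times [k!], is the value at [v = 0] of the [k]-th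
    derivative; each derivation raises one of the indices. *)
Lemma coef_prod_phi k (m : vec) (t : r.-tuple C) :
  fps_coef (\prod_i phi (m i) t) k *+ k`! = (hwalk k m).@[tnth t].
Proof.
elim: k m => [|k IHk] m.
  rewrite /= mulr1n rmorph_prod /=.
  have c0 (f g : fps C) : fps_coef (f * g) 0 = fps_coef f 0 * fps_coef g 0.
    by rewrite coef_fpsM big_ord1.
  rewrite (big_morph (fun f => fps_coef f 0) c0 (coef_fps1 _ 0)).
  apply: eq_bigr => i _; rewrite /= add0r.
  by case: (m i) => q; rewrite ?meval0 // fact0 divr1 meval_hpoly.
rewrite factS mulrnA -[fps_coef _ k.+1 *+ k.+1]/(fps_coef (fps_deriv _) k).
rewrite (leibniz_prod (fps_deriv1 _) (@fps_derivM _)) coef_fps_sum /= raddf_sum.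
rewrite -sumrMnl; apply: eq_bigr => i _; rewrite [RHS]/= -IHk.
by rewrite (@prod_add_at _ (fun k => phi k t) _ m i 1 (fun l => phiS_deriv l t)).
Qed.

Definition det_exponent (s : 'S_d) : vec := [ffun i : 'I_d => i%:Z - (s i)%:Z].

Lemma coef_det_toeplitz k (t : r.-tuple C) :
  fps_coef (\det (toeplitz d t)) k =
  ((k`!%:R)^-1 *: \sum_(s : 'S_d) (-1) ^+ s *: hwalk k (det_exponent s)).@[tnth t].
Proof.
rewrite /determinant coef_fps_sum mevalZ raddf_sum mulr_sumr; apply: eq_bigr => s _.
rewrite [X in _ = _ * X]/= mevalZ -coef_prod_phi mulrCA.
rewrite -[X in _ * (_ * X)]mulr_natl mulKf; last first.
  by rewrite pnatr_eq0 -lt0n fact_gt0.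
have -> : \prod_i toeplitz d t i (s i) = \prod_i phi (det_exponent s i) t.
  by apply: eq_bigr => i _; rewrite mxE ffunE.
case: (odd_perm s); last by rewrite !expr0 !mul1r.
by rewrite !expr1 !mulN1r -[LHS]/(- fps_coef _ k).
Qed.

End HProducts.

(** * The cycle index as a sum over permutations *)

Section CycleIndex.
Variable r : nat.

Lemma sorted_geq_zeros (s : seq nat) : sorted geq s ->
  s = [seq m <- s | (0 < m)%N] ++ nseq (size s - size [seq m <- s | (0 < m)%N]) 0%N.
Proof.
elim: s => // [[|x] s] IHs /= ps; last by congr cons; apply: IHs; exact: path_sorted ps.
have s0 : all (fun m => m == 0%N) s.
  have := order_path_min (fun y x z h1 h2 => leq_trans h2 h1) ps.
  by apply: sub_all => m; rewrite /= leqn0.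
have -> : [seq m <- s | (0 < m)%N] = [::].
  by apply/eqP; rewrite -[_ == _]negbK -has_filter -all_predC;
    apply: sub_all s0 => m /eqP ->.
by rewrite subn0 /=; congr cons; apply/all_pred1P.
Qed.

Lemma sorted_geq_cat_zeros (s : seq nat) n : sorted geq s -> sorted geq (s ++ nseq n 0%N).
Proof.
have pz y k : path geq y (nseq k 0%N) by elim: k y => //= k IHk y; rewrite IHk.
by case: s => [|x s] /= ss; [case: n => //= n|rewrite cat_path ss pz].
Qed.

Lemma sum_porbits (V : nmodType) (s : 'S_r) (F : 'I_r -> V) :
  \sum_i F i = \sum_(B in porbits s) \sum_(i | porbit s i == B) F i.
Proof.
rewrite (partition_big (porbit s) (fun B => B \in porbits s)) //.
by move=> i _; exact: imset_f.
Qed.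

Lemma mem_porbits (s : 'S_r) B i : B \in porbits s -> (porbit s i == B) = (i \in B).
Proof.
move=> /imsetP[j _ ->]; rewrite eq_porbit_mem porbit_sym; by [].
Qed.

Lemma cycle_lengths_bounds (s : 'S_r) l : l \in cycle_lengths s -> (0 < l <= r)%N.
Proof.
move=> /mapP[B]; rewrite mem_enum => /imsetP[j _ ->] ->.
apply/andP; split; first by apply/card_gt0P; exists j; exact: porbit_id.
by rewrite -[leqRHS](card_ord r) max_card.
Qed.

Lemma sumn_cycle_lengths (s : 'S_r) : sumn (cycle_lengths s) = r.
Proof.
rewrite /cycle_lengths sumnE big_map big_enum /=.
rewrite -[RHS](card_ord r) -sum1_card (sum_porbits s (fun=> 1%N)).
apply: eq_bigr => B hB; rewrite -sum1_card; apply: eq_bigl => i.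
by rewrite (mem_porbits _ hB).
Qed.

Lemma size_cycle_lengths (s : 'S_r) : (size (cycle_lengths s) <= r)%N.
Proof.
rewrite -[X in (_ <= X)%N](sumn_cycle_lengths s).
have := @cycle_lengths_bounds s.
elim: (cycle_lengths s) => //= l ls IHls hl.
have l0 : (0 < l)%N by have /andP[] := hl l (mem_head _ _).
have := IHls (fun k hk => hl k (mem_behead (s := l :: ls) hk)).
by move: l0; lia.
Qed.

Definition cycle_type (s : 'S_r) : r.-tuple 'I_r.+1 :=
  [tuple inord (nth 0%N (sort geq (cycle_lengths s)) i) | i < r].

Lemma map_val_cycle_type s : map val (cycle_type s) =
  sort geq (cycle_lengths s) ++ nseq (r - size (cycle_lengths s)) 0%N.
Proof.
have sz := size_cycle_lengths s.
apply: (@eq_from_nth _ 0%N) => [|i].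
  by rewrite size_map size_tuple size_cat size_sort size_nseq subnKC.
rewrite size_map size_tuple => lt_ir.
rewrite (nth_map ord0) ?size_tuple //.
have -> : nth ord0 (cycle_type s) i = tnth (cycle_type s) (Ordinal lt_ir).
  by rewrite (tnth_nth ord0).
rewrite tnth_mktuple.
rewrite nth_cat nth_nseq if_same size_sort /=.
case: ltnP => [lt_is|le_si]; last by rewrite nth_default ?size_sort // inordK.
rewrite inordK // ltnS.
have : nth 0%N (sort geq (cycle_lengths s)) i \in cycle_lengths s.
  by rewrite -(mem_sort geq) mem_nth // size_sort.
by move=> /cycle_lengths_bounds/andP[].
Qed.

Lemma geq_sort_sorted (s : seq nat) : sorted geq (sort geq s).
Proof. by apply: sort_sorted => x y; rewrite /= leq_total. Qed.

Lemma cycle_typeP s (mu : r.-tuple 'I_r.+1) :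
  is_partition mu && perm_eq (cycle_lengths s) (parts mu) = (mu == cycle_type s).
Proof.
have szc := size_cycle_lengths s.
have srt : sorted (fun a b : 'I_r.+1 => (b <= a)%N) mu = sorted geq (map val mu).
  by rewrite sorted_map.
have sm : (\sum_(i < r) tnth mu i = sumn (map val mu))%N.
  by rewrite sumnE big_map big_tuple.
have pos : all (fun m => 0 < m)%N (cycle_lengths s).
  by apply/allP => l /cycle_lengths_bounds/andP[].
rewrite /is_partition srt sm /parts; apply/idP/eqP => [/andP[/andP[hs _] hp]|->].
  have e : [seq m <- map val mu | (0 < m)%N] = sort geq (cycle_lengths s).
    apply: (@sorted_eq _ geq).
    - by move=> y x z h1 h2; exact: leq_trans h2 h1.
    - by move=> x y /andP[h1 h2]; apply/eqP; rewrite eqn_leq; apply/andP.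
    - by apply: sorted_filter hs => y x z h1 h2; exact: leq_trans h2 h1.
    - exact: geq_sort_sorted.
    - by rewrite perm_sym perm_sort.
  apply: val_inj; apply: (inj_map val_inj).
  rewrite map_val_cycle_type (sorted_geq_zeros hs) e.
  by rewrite size_sort size_map size_tuple.
rewrite map_val_cycle_type.
have -> : [seq m <- sort geq (cycle_lengths s) ++
    nseq (r - size (cycle_lengths s)) 0%N | (0 < m)%N] = sort geq (cycle_lengths s).
  rewrite filter_cat.
  have -> : [seq m <- nseq (r - size (cycle_lengths s)) 0%N | (0 < m)%N] = [::].
    by elim: (r - _)%N.
  by rewrite cats0; apply/all_filterP; rewrite all_sort.
rewrite perm_sym perm_sort perm_refl andbT; apply/andP; split.
  exact/sorted_geq_cat_zeros/geq_sort_sorted.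
rewrite sumn_cat sumn_nseq mul0n addn0.
rewrite -[eqbRHS](sumn_cycle_lengths s) !sumnE.
by apply/eqP/perm_big; rewrite perm_sort.
Qed.

(** Grouping the permutations by cycle type: a permutation belongs to the class
    of exactly one partition, its cycle type padded with zeros. *)
Lemma sum_cycle_class (A : comPzSemiRingType) (f : nat -> A) :
  \sum_(mu : r.-tuple 'I_r.+1 | is_partition mu)
    #|cycle_class mu|%:R * \prod_(m <- parts mu) f m =
  \sum_(s : 'S_r) \prod_(l <- cycle_lengths s) f l.
Proof.
transitivity (\sum_(mu : r.-tuple 'I_r.+1 | is_partition mu)
    \sum_(s in cycle_class mu) \prod_(l <- cycle_lengths s) f l).
  apply: eq_bigr => mu _; rewrite mulr_natl -sumr_const; apply: eq_bigr => s.
  by rewrite inE => hs; rewrite (perm_big _ hs).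
rewrite (exchange_big_dep predT) //=; apply: eq_bigr => s _.
rewrite (eq_bigl (pred1 (cycle_type s))) ?big_pred1_eq // => mu.
by rewrite inE cycle_typeP.
Qed.

End CycleIndex.

(** * Counting colourings fixed by a permutation *)

Section Colourings.
Variables (r d : nat).
Local Notation vec := {ffun 'I_d -> int}.
Local Notation colouring := {ffun 'I_r -> 'I_d}.

Definition colour_count (x : colouring) (i : 'I_d) : nat := #|[pred a | x a == i]|.

Definition minus_count (m : vec) (c : 'I_d -> nat) : vec := [ffun i => m i - (c i)%:Z].

Definition invariant_colouring (s : 'S_r) (x : colouring) : bool :=
  [forall a, x (s a) == x a].

Lemma invariant_colouringP (s : 'S_r) (x : colouring) :
  reflect (forall a b, b \in porbit s a -> x b = x a) (invariant_colouring s x).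
Proof.
apply: (iffP forallP) => [h a b /porbitP[n ->]|h a].
  elim: n => [|n IHn]; first by rewrite expg0 perm1.
  by rewrite expgSr permM (eqP (h _)).
by apply/eqP/h; have := mem_porbit s 1 a; rewrite expg1.
Qed.

Lemma sum_tupleS (V : nmodType) (T : finType) b (F : b.+1.-tuple T -> V) :
  \sum_(y : b.+1.-tuple T) F y = \sum_(i : T) \sum_(y : b.-tuple T) F [tuple of i :: y].
Proof.
rewrite pair_bigA /= (reindex (fun p : T * b.-tuple T => [tuple of p.1 :: p.2])) //=.
exists (fun y : b.+1.-tuple T => (thead y, [tuple of behead y])) => [[i y] _|y _] /=.
  by congr pair; apply/val_inj.
by rewrite [RHS]tuple_eta.
Qed.

(** The shifts of the indices made by the derivations with respect to
    [t_l], for [l] in [ls]. *)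
Fixpoint step_sum (V : nmodType) (G : vec -> V) (ls : seq nat) (m : vec) : V :=
  if ls is l :: ls' then \sum_(i < d) step_sum G ls' (add_at m i (- l%:Z)) else G m.

Lemma step_sumE (V : nmodType) (G : vec -> V) (ls : seq nat) (m : vec) :
  step_sum G ls m = \sum_(y : (size ls).-tuple 'I_d)
    G (minus_count m (fun i => \sum_(p <- zip y ls | p.1 == i) p.2)%N).
Proof.
elim: ls m => [|l ls IHls] m /=.
  rewrite (big_pred1 [tuple]) => [|y]; last by apply/esym/eqP; exact: tuple0.
  by congr G; apply/ffunP => i; rewrite ffunE big_nil subr0.
rewrite sum_tupleS; apply: eq_bigr => i _; rewrite IHls; apply: eq_bigr => y _.
congr G; apply/ffunP => k; rewrite !ffunE /= big_cons /= eq_sym.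
by case: eqP => _; lia.
Qed.

Variable i0 : 'I_d.

Definition colouring_of_seq (s : 'S_r) (y : seq 'I_d) : colouring :=
  [ffun a => nth i0 y (index (porbit s a) (enum (porbits s)))].

(** To choose, for each cycle of [s], the index lowered by the length of that
    cycle is to colour the points by indices with constant colour on each cycle;
    an index is then lowered by the number of points of its colour. *)
Lemma step_sum_cycles (V : nmodType) (G : vec -> V) (s : 'S_r) (m : vec) :
  step_sum G (cycle_lengths s) m =
  \sum_(x : colouring | invariant_colouring s x) G (minus_count m (colour_count x)).
Proof.
set b := size (cycle_lengths s); pose Bs : seq {set 'I_r} := enum (porbits s).
have sB : size Bs = b by rewrite /b /cycle_lengths size_map.
pose z : {set 'I_r} := finset.set0.
pose tuple_of (x : colouring) : b.-tuple 'I_d :=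
  [tuple odflt i0 (omap x [pick a in nth z Bs k]) | k < b].
have uB : uniq Bs := enum_uniq _.
have inB a : porbit s a \in Bs by rewrite mem_enum imset_f.
have idx a : (index (porbit s a) Bs < b)%N by rewrite -sB index_mem.
(* An invariant colouring is the tuple of the colours of the cycles, each read
   at an arbitrary point of the cycle. *)
rewrite (reindex_onto (fun y : b.-tuple 'I_d => colouring_of_seq s y) tuple_of) /=; last first.
  move=> x /invariant_colouringP hx; apply/ffunP => a; rewrite ffunE.
  rewrite -/Bs (nth_map (Ordinal (idx a))) ?size_enum_ord // nth_enum_ord // nth_index //.
  by case: pickP => [c /hx //|/(_ a)]; rewrite porbit_id.
rewrite step_sumE; apply: eq_big => [y|y _].
  apply/esym/andP; split.
    apply/invariant_colouringP => a c hc; rewrite !ffunE; congr (nth _ _ (index _ _)).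
    by apply/eqP; rewrite eq_porbit_mem.
  apply/eqP/eq_from_tnth => k; rewrite tnth_mktuple.
  have lt_k : (k < size Bs)%N by rewrite sB.
  have hk : nth z Bs k \in porbits s by rewrite -mem_enum mem_nth.
  case: pickP => [c hc|h] /=.
    rewrite ffunE -/Bs (_ : porbit s c = nth z Bs k).
      by rewrite index_uniq // -tnth_nth.
    by apply/eqP; rewrite mem_porbits.
  by case/imsetP: hk => c _ e; move: (h c); rewrite e porbit_id.
congr G; apply/ffunP => i; rewrite !ffunE; congr (_ - _%:Z).
move: (size_tuple y : size y = b).
move: (tval y) => {}y sy.
rewrite /colour_count -sum1_card [RHS]big_mkcond (sum_porbits s).
rewrite -big_enum /= -/Bs.
rewrite /cycle_lengths -/Bs.
have -> : zip y [seq #|pred_of_set B| | B <- Bs] =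
    [seq (nth i0 y (index B Bs), #|pred_of_set B|) | B <- Bs].
  have sc : size [seq #|pred_of_set B| | B <- Bs] = b by rewrite size_map.
  apply: (@eq_from_nth _ (i0, 0%N)) => [|k].
    by rewrite size_zip sy sc minnn size_map sB.
  rewrite size_zip sy sc minnn => lt_k.
  rewrite nth_zip ?sy ?sc // !(nth_map z) ?sB //.
  by rewrite index_uniq // sB.
rewrite big_map [LHS]big_mkcond; apply: eq_big_seq => B; rewrite mem_enum => hB /=.
case: eqP => [e|ne].
  rewrite -sum1_card [RHS](eq_bigl (fun a => a \in B)) => [|a]; last exact: mem_porbits.
  apply: eq_bigr => a aB; rewrite inE ffunE.
  by move: aB; rewrite -(mem_porbits _ hB) => /eqP ->; rewrite -/Bs e eqxx.
rewrite big1 // => a /eqP aB; rewrite inE ffunE aB -/Bs.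
by case: eqP.
Qed.

Lemma sum_colour_count x : \sum_(i < d) colour_count x i = r.
Proof.
rewrite -[RHS](card_ord r) -sum1_card (partition_big x predT) //=.
by apply: eq_bigr => i _; rewrite /colour_count -sum1_card; apply: eq_bigl => a; rewrite inE.
Qed.

Definition permute_colouring (x : colouring) (s : 'S_r) : colouring := [ffun a => x (s a)].

Lemma colour_count_permute x s i : colour_count (permute_colouring x s) i = colour_count x i.
Proof.
rewrite /colour_count -[LHS](card_imset _ (@perm_inj _ s)); apply: eq_card => b.
rewrite inE; apply/imsetP/idP => [[a]|h]; first by rewrite inE ffunE => h ->.
by exists ((s^-1)%g b); rewrite ?inE ?ffunE permKV.
Qed.

Lemma count_mem_colouring (z : colouring) i :
  count_mem i [tuple z a | a < r] = colour_count z i.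
Proof.
rewrite /colour_count -sum1_card count_map -sum1_count val_ord_tuple.
by rewrite big_enum_cond.
Qed.

Lemma colour_count_inj x x' : colour_count x =1 colour_count x' ->
  exists s, x' = permute_colouring x s.
Proof.
move=> h.
have : perm_eq [tuple x' a | a < r] [tuple x a | a < r].
  by apply/allP => i _; rewrite /= !count_mem_colouring h.
move=> /tuple_permP[s hs]; exists s; apply/ffunP => a; rewrite ffunE.
have /(congr1 (fun t : r.-tuple 'I_d => tnth t a)) :
  [tuple x' a | a < r] = [tuple tnth [tuple x a | a < r] (s i) | i < r] by apply: val_inj.
by rewrite !tnth_mktuple.
Qed.

Lemma colour_count_surj (c : 'I_d -> nat) : (\sum_i c i)%N = r ->
  exists x, colour_count x =1 c.
Proof.
move=> cr; pose l := flatten [seq nseq (c j) j | j <- enum 'I_d].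
have sl : size l == r.
  rewrite size_flatten /shape -map_comp sumnE big_map big_enum /= -[eqbRHS]cr.
  by apply/eqP; apply: eq_bigr => i _; rewrite size_nseq.
exists [ffun a => tnth (Tuple sl) a] => i; rewrite -count_mem_colouring.
have -> : [tuple [ffun a => tnth (Tuple sl) a] a | a < r] = Tuple sl.
  by apply: eq_from_tnth => a; rewrite tnth_mktuple ffunE.
rewrite /= count_flatten -map_comp sumnE big_map big_enum /=.
rewrite (bigD1 i) //= big1 => [|j ji]; first by rewrite count_nseq /= eqxx mul1n addn0.
by rewrite count_nseq /= (negPf ji).
Qed.

Definition stabilizer_size (x : colouring) : nat := #|[pred s | invariant_colouring s x]|.

(** The orbit-stabilizer count: the symmetric group acts transitively on the
    colourings with prescribed numbers of points of each colour, so every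
    permutation is accounted for once by the colouring it leads to. *)
Lemma sum_stabilizer_size (c : 'I_d -> nat) : (\sum_i c i)%N = r ->
  (\sum_(x : colouring | [forall i, colour_count x i == c i]) stabilizer_size x)%N = r`!.
Proof.
move=> /colour_count_surj[x0 hx0].
rewrite -[RHS](card_Sn r) -sum1_card (partition_big (permute_colouring x0)
  (fun x : colouring => [forall i, colour_count x i == c i])) /=; last first.
  by move=> s _; apply/forallP => i; rewrite colour_count_permute hx0.
apply: eq_bigr => x /forallP hx.
have [t ht] : exists t, x = permute_colouring x0 t.
  by apply: colour_count_inj => i; rewrite hx0 (eqP (hx i)).
rewrite /stabilizer_size -sum1_card [RHS](reindex_inj (mulIg t)) /=.
apply: eq_bigl => s; rewrite inE; apply/forallP/eqP => [h|h a].
  by apply/ffunP => a; rewrite ffunE permM -(eqP (h a)) ht ffunE.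
by apply/eqP; rewrite -{2}h ht !ffunE permM.
Qed.

(** Exchanging the sums, a colouring is weighted by its stabilizer, and the
    stabilizers of the colourings of a given content add up to [r!]. *)
Lemma sum_invariant_colourings (V : zmodType) (G : vec -> V) (m : vec) :
  \sum_(s : 'S_r) \sum_(x : colouring | invariant_colouring s x)
    G (minus_count m (colour_count x)) =
  (\sum_(c : {ffun 'I_d -> 'I_r.+1} | (\sum_i c i == r)%N) G (minus_count m (fun i => c i))) *+ r`!.
Proof.
rewrite (exchange_big_dep predT) //=.
have bound (x : colouring) i : (colour_count x i < r.+1)%N.
  by rewrite ltnS -[leqRHS](sum_colour_count x) (bigD1 i) //= leq_addr.
pose kappa (x : colouring) : {ffun 'I_d -> 'I_r.+1} :=
  [ffun i => Ordinal (bound x i)].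
rewrite (partition_big kappa (fun c : {ffun 'I_d -> 'I_r.+1} => (\sum_i c i == r)%N)) /=;
  last first.
  move=> x _; rewrite -[eqbRHS](sum_colour_count x); apply/eqP.
  by apply: eq_bigr => i _; rewrite ffunE.
rewrite -sumrMnl; apply: eq_bigr => c /eqP cr.
rewrite -(@sum_stabilizer_size (fun i => c i) cr) -sumrMnr.
have kE x : (kappa x == c) = [forall i, colour_count x i == c i].
  apply/eqP/forallP => [<- i|h]; first by rewrite ffunE.
  by apply/ffunP => i; rewrite ffunE; apply/val_inj/eqP/h.
apply: eq_big => [x|x]; first exact: kE.
rewrite kE => /forallP hx; rewrite /stabilizer_size sumr_const; congr (G _ *+ _).
by apply/ffunP => i; rewrite !ffunE (eqP (hx i)).
Qed.

End Colourings.

(** * The adjoint of multiplication by the cycle index *)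

Section CyclePolynomial.
Variables (R : realType) (r d : nat).
Local Notation C := R[i].
Local Notation P := {mpoly C[r]}.
Local Notation vec := {ffun 'I_d -> int}.

Definition cycle_var (l : nat) : P := nth 0 [tuple 'X_j | j < r] l.-1.

(** The cycle index as a polynomial.  The sum runs over permutations instead of
    cycle types, which is the form in which colourings can be counted. *)
Definition cycle_poly : P :=
  (r`!%:R)^-1 *: \sum_(s : 'S_r) \prod_(l <- cycle_lengths s) cycle_var l.

Lemma meval_cycle_poly (t : r.-tuple C) : cycle_poly.@[tnth t] = Cyc t.
Proof.
rewrite /cycle_poly mevalZ /Cyc; congr (_ * _).
rewrite (sum_cycle_class r (fun m => nth 0 t m.-1)) raddf_sum.
apply: eq_bigr => s _ /=; rewrite rmorph_prod; apply: eq_bigr => l _ /=.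
rewrite /cycle_var; case: (ltnP l.-1 r) => [lr|rl]; last first.
  by rewrite !nth_default ?size_tuple // meval0.
rewrite -[l.-1]/(val (Ordinal lr)) -!tnth_nth tnth_mktuple mevalXU.
by [].
Qed.

Lemma pairing_cycle_vars (ls : seq nat) (m : vec) q :
  {in ls, forall l, (0 < l <= r)%N} ->
  pairing (hprod R r m) (\prod_(l <- ls) cycle_var l * q) =
  step_sum (fun m => pairing (hprod R r m) q) ls m.
Proof.
elim: ls m => [|l ls IHls] m hls; first by rewrite big_nil mul1r.
have /andP[l0 lr] := hls l (mem_head _ _).
have l1r : (l.-1 < r)%N by lia.
rewrite big_cons -mulrA.
have -> : cycle_var l = 'X_(Ordinal l1r).
  by rewrite /cycle_var -[l.-1]/(val (Ordinal l1r)) -tnth_nth tnth_mktuple.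
rewrite pairing_hprod_mulX /= prednK //; apply: eq_bigr => i _; apply: IHls => k hk.
by apply: hls; rewrite inE hk orbT.
Qed.

Variable i0 : 'I_d.

(** In symmetric function terms the cycle index is the complete function of
    degree [r] in the power sums, whose adjoint removes [r] from the indices in
    all possible ways. *)
Lemma pairing_cycle_poly (m : vec) q :
  pairing (hprod R r m) (cycle_poly * q) =
  \sum_(c : {ffun 'I_d -> 'I_r.+1} | (\sum_i c i == r)%N)
    pairing (hprod R r (minus_count m (fun i => c i))) q.
Proof.
rewrite /cycle_poly -scalerAl pairingZr mulr_suml pairing_sumr.
pose G (m : vec) := pairing (hprod R r m) q.
transitivity (conjc (r`!%:R)^-1 * \sum_(s : 'S_r) \sum_(x | invariant_colouring s x)
    G (minus_count m (colour_count x))).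
  congr (_ * _); apply: eq_bigr => s _.
  rewrite pairing_cycle_vars; last by move=> l; exact: cycle_lengths_bounds.
  exact: (step_sum_cycles i0).
rewrite (sum_invariant_colourings r G).
rewrite -[X in _ * X = _]mulr_natl mulrA fmorphV rmorph_nat mulVf ?mul1r //.
Qed.

End CyclePolynomial.

Local Close Scope complex_scope.

(** * Cancellation outside the chamber *)

Section Chamber.
Variable d : nat.
Local Notation vec := {ffun 'I_d -> int}.
Implicit Types a b : vec.

(** The encoding [i + 0] of the empty shape. *)
Definition delta : vec := [ffun i : 'I_d => i%:Z].

Definition chamber (a : vec) : bool :=
  [forall i : 'I_d, forall j : 'I_d, (i < j)%N ==> (a i < a j)].

(** For the shapes encoded by [a] and [b], this says that their difference is
    a horizontal strip: no two of its boxes lie in the same column. *)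
Definition interlaces (b a : vec) : bool :=
  [forall i, b i <= a i] && [forall i : 'I_d, forall j : 'I_d, (i < j)%N ==> (a i < b j)].

Definition content (a : vec) : int := \sum_i a i.

Lemma chamberP a :
  reflect (forall i j : 'I_d, (i < j)%N -> a i < a j) (chamber a).
Proof.
apply: (iffP forallP) => [h i j ij|h i].
  by have /forallP/(_ j)/implyP := h i; apply.
by apply/forallP => j; apply/implyP; exact: h.
Qed.

Lemma interlacesP b a :
  reflect ((forall i, b i <= a i) /\ (forall i j : 'I_d, (i < j)%N -> a i < b j))
    (interlaces b a).
Proof.
apply: (iffP andP) => [[/forallP h1 /forallP h2]|[h1 h2]]; split.
- exact: h1.
- by move=> i j ij; have /forallP/(_ j)/implyP := h2 i; apply.
- exact/forallP.
- by apply/forallP => i; apply/forallP => j; apply/implyP; exact: h2.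
Qed.

Lemma interlaces_chamber b a : interlaces b a -> chamber b.
Proof.
move=> /interlacesP[h1 h2]; apply/chamberP => i j ij.
exact: le_lt_trans (h1 i) (h2 i j ij).
Qed.

Lemma delta_chamber : chamber delta.
Proof. by apply/chamberP => i j ij; rewrite !ffunE ltz_nat. Qed.

Variable r : nat.

Definition lowered (a : vec) : seq vec :=
  map (fun c : {ffun 'I_d -> 'I_r.+1} => minus_count a (fun i => c i))
    (seq.filter (fun c : {ffun 'I_d -> 'I_r.+1} => \sum_i c i == r)%N
      (enum {: {ffun 'I_d -> 'I_r.+1}})).

Lemma mem_lowered a b :
  (b \in lowered a) = [forall i, b i <= a i] && (content a == content b + r%:Z).
Proof.
apply/mapP/andP => [[c]|[/forallP le_ba /eqP cab]].
  rewrite mem_filter => /andP[/eqP cr _] ->; split.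
    by apply/forallP => i; rewrite ffunE; lia.
  have -> : r%:Z = \sum_i (c i)%:Z by rewrite -(big_morph _ PoszD erefl) /= cr.
  rewrite /content -big_split /=; apply/eqP.
  by apply: eq_bigr => i _; rewrite ffunE; lia.
have s_ab : (\sum_i `|a i - b i|)%N = r.
  apply/eqP; rewrite -eqz_nat (big_morph _ PoszD erefl) /=; apply/eqP.
  transitivity (\sum_i (a i - b i)).
    by apply: eq_bigr => i _; have := le_ba i; lia.
  by rewrite sumrB -/(content a) -/(content b) cab addrAC subrr add0r.
have bd i : (`|a i - b i| < r.+1)%N.
  by rewrite ltnS -[leqRHS]s_ab (bigD1 i) //= leq_addr.
exists [ffun i => Ordinal (bd i)].
  rewrite mem_filter mem_enum andbT -[eqbRHS]s_ab; apply/eqP.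
  by apply: eq_bigr => i _; rewrite ffunE.
by apply/ffunP => i; rewrite !ffunE /=; have := le_ba i; lia.
Qed.

Lemma uniq_lowered a : uniq (lowered a).
Proof.
rewrite map_inj_uniq; first by rewrite filter_uniq // enum_uniq.
move=> c c' /ffunP h.
by apply/ffunP => i; apply: val_inj; have := h i; rewrite !ffunE /=; lia.
Qed.

Lemma sum_lowered (V : nmodType) (F : vec -> V) a :
  \sum_(c : {ffun 'I_d -> 'I_r.+1} | (\sum_i c i == r)%N)
    F (minus_count a (fun i => c i)) = \sum_(b <- lowered a) F b.
Proof. by rewrite big_map big_filter big_enum_cond. Qed.

(** The sequences of shapes from [a] down to the empty one in which each
    difference is a horizontal strip of [r] boxes: these are the semistandard
    tableaux of shape [a] in which each of [n] letters occurs [r] times. *)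
Fixpoint chains (n : nat) (a : vec) : seq (seq vec) :=
  if n is n'.+1 then
    [seq a :: P | b <- [seq b <- lowered a | interlaces b a], P <- chains n' b]
  else if a == delta then [:: [:: a]] else [::].

(** The walks that stay in the chamber are the standard tableaux, in which a box
    is added at each step. *)
Fixpoint walk_sum (V : nmodType) (F : vec -> V) (k : nat) (a : vec) : V :=
  if k is k'.+1 then \sum_(i | chamber (add_at a i 1)) walk_sum F k' (add_at a i 1)
  else F a.

End Chamber.

Section Antisymmetry.
Variables (K : numDomainType) (d r : nat).
Local Notation vec := {ffun 'I_d -> int}.
Implicit Types a b : vec.

Definition permv (a : vec) (p : 'S_d) : vec := [ffun i => a (p i)].

Definition antisymmetric_fun (F : vec -> K) : Prop :=
  forall a p, F (permv a p) = (-1) ^+ p * F a.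

Lemma antisymmetric_eq0 F a (i j : 'I_d) :
  antisymmetric_fun F -> i != j -> a i = a j -> F a = 0.
Proof.
move=> antiF ij aij; have := antiF a (tperm i j).
rewrite odd_tperm ij expr1 mulN1r (_ : permv a _ = a) => [e|].
  by apply/eqP; rewrite -eqNr -e.
apply/ffunP => k; rewrite ffunE; case: tpermP => // ->; by rewrite aij.
Qed.

Lemma antisymmetric_unit_step F : antisymmetric_fun F ->
  antisymmetric_fun (fun a => \sum_i F (add_at a i 1)).
Proof.
move=> antiF a p; rewrite mulr_sumr [RHS](reindex_inj (@perm_inj _ p)) /=.
apply: eq_bigr => i _; rewrite -antiF; congr F; apply/ffunP => k.
by rewrite !ffunE (inj_eq perm_inj).
Qed.

(** A unit step out of the chamber makes two coordinates equal. *)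
Lemma sum_unit_step F a : antisymmetric_fun F -> chamber a ->
  \sum_i F (add_at a i 1) = \sum_(i | chamber (add_at a i 1)) F (add_at a i 1).
Proof.
move=> antiF /chamberP ha; rewrite (bigID (fun i => chamber (add_at a i 1))) /=.
rewrite [X in _ + X]big1 ?addr0 // => i ni.
suff [j ij e] : exists2 j, i != j & add_at a i 1 i = add_at a i 1 j.
  exact: antisymmetric_eq0 antiF ij e.
move: ni; rewrite negb_forall => /existsP[k]; rewrite negb_forall => /existsP[l].
rewrite negb_imply !ffunE => /andP[kl]; have := ha _ _ kl.
have [ki|ki] := eqVneq k i; have [li|li] := eqVneq l i; subst.
- by move: kl; rewrite ltnn.
- by exists l; rewrite 1?eq_sym // !ffunE eqxx (negPf li); lia.
- by lia.
- by lia.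
Qed.

(** A sign-reversing involution on the [b] that do not interlace [a].  Let [j] be
    the last index such that [b j <= a i] for some [i < j]; then [b j] and
    [b (j - 1)] are both at most [a (j - 1)], so exchanging them keeps [b] below [a],
    and does not change [j]. *)
Lemma sum_lowered_interlacing F a : antisymmetric_fun F -> chamber a ->
  \sum_(b <- lowered r a) F b = \sum_(b <- lowered r a | interlaces b a) F b.
Proof.
move=> antiF /chamberP ha; rewrite (bigID (fun b => interlaces b a)) /=.
rewrite [X in _ + X](_ : _ = 0) ?addr0 // -big_filter.
set L := [seq b <- _ | _].
pose bad (b : vec) (j : 'I_d) := [exists i : 'I_d, (i < j)%N && (b j <= a i)].
pose last_bad b j := bad b j && [forall k : 'I_d, (j < k)%N ==> ~~ bad b k].
pose pr (j : 'I_d) : 'I_d := Ordinal (leq_ltn_trans (leq_pred j) (ltn_ord j)).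
pose f b := if [pick j | last_bad b j] is Some j then permv b (tperm (pr j) j) else b.
have LP b : b \in L -> exists2 j, last_bad b j & f b = permv b (tperm (pr j) j).
  rewrite mem_filter => /andP[nI]; rewrite mem_lowered => /andP[/forallP le_ba _].
  rewrite /f; case: pickP => [j hj|h]; first by exists j.
  have /existsP[j0 hj0] : [exists j, bad b j].
    apply: contraNT nI => /existsPn hb; apply/interlacesP; split=> // i j ij.
    by rewrite ltNge; apply: contraNN (hb j) => h0; apply/existsP; exists i; rewrite ij.
  case: (arg_maxnP (fun j : 'I_d => val j) hj0) => j hj jmax.
  have := h j; rewrite /last_bad hj /= => /negP[]; apply/forallP => k.
  by apply/implyP => jk; apply/negP => /jmax /=; rewrite leqNgt jk.
have fL b : b \in L -> [/\ f b \in L, f (f b) = b & F (f b) = - F b].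
  move=> bL; have [j hj fb] := LP _ bL.
  move: (bL); rewrite mem_filter mem_lowered => /and3P[_ /forallP le_ba /eqP cab].
  have /andP[/existsP[i /andP[ij bj]] /forallP hmax] := hj.
  have pj : (pr j < j)%N by rewrite /=; case: (val j) ij.
  have bjp : b j <= a (pr j).
    apply: le_trans bj _; have [->//|ne] := eqVneq i (pr j).
    by apply/ltW/ha; move: ne; rewrite -val_eqE /=; lia.
  have pjF : (pr j == j) = false by apply/negbTE; rewrite -val_eqE ltn_eqF.
  have lastF : last_bad (f b) j.
    apply/andP; split.
      by apply/existsP; exists (pr j); rewrite pj fb ffunE tpermR le_ba.
    apply/forallP => k; apply/implyP => jk; have /implyP/(_ jk) := hmax k.
    apply: contra => /existsP[l /andP[lk hl]]; apply/existsP; exists l.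
    move: hl; rewrite lk fb ffunE tpermD // -val_eqE neq_ltn ?jk //.
    by rewrite (ltn_trans pj jk).
  have fbL : f b \in L.
    rewrite mem_filter mem_lowered; apply/and3P; split.
    - apply/negP => /interlacesP[_ /(_ _ _ pj)].
      by rewrite fb ffunE tpermR ltNge le_ba.
    - apply/forallP => k; rewrite fb ffunE; case: tpermP => [->//|->|_ _//].
      exact: le_trans (le_ba _) (ltW (ha _ _ pj)).
    - rewrite cab fb /content (reindex_inj (@perm_inj _ (tperm (pr j) j))) /=.
      by apply/eqP; congr (_ + _); apply: eq_bigr => k _; rewrite ffunE.
  split=> //; last by rewrite fb antiF odd_tperm pjF expr1 mulN1r.
  have [k hk ->] := LP _ fbL.
  have -> : k = j.
    apply/eqP; rewrite -val_eqE; move: hk lastF => /andP[k1 /forallP k2] /andP[j1 /forallP j2].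
    case: ltngtP => // kj; first by have := k2 j; rewrite kj j1.
    by have := j2 k; rewrite kj k1.
  by rewrite fb; apply/ffunP => l; rewrite !ffunE tpermK.
have pL : perm_eq (map f L) L.
  apply: uniq_perm; rewrite ?filter_uniq ?uniq_lowered //.
    rewrite map_inj_in_uniq ?filter_uniq ?uniq_lowered // => b c bL cL e.
    have [_ <- _] := fL _ bL; have [_ <- _] := fL _ cL; by rewrite e.
  move=> b; apply/mapP/idP => [[c cL ->]|bL]; first by have [] := fL _ cL.
  by have [h1 h2 _] := fL _ bL; exists (f b).
have : \sum_(b <- L) F b = - \sum_(b <- L) F b.
  rewrite -{1}(perm_big _ pL) big_map -sumrN /=; apply: eq_big_seq => b bL.
  by have [] := fL _ bL.
by move=> e; apply/eqP; rewrite -eqNr -e.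
Qed.

End Antisymmetry.

(** [c n m] counts the paths from [m] to the origin by [n] steps down of total
    length [r] each. *)
Section AlternatingSums.
Variables (K : numDomainType) (d r : nat) (c : nat -> {ffun 'I_d -> int} -> K).
Local Notation vec := {ffun 'I_d -> int}.
Implicit Types a b m : vec.

Hypothesis c0 : forall m, c 0 m = (m == [ffun=> 0])%:R.
Hypothesis cS : forall n m, c n.+1 m =
  \sum_(k : {ffun 'I_d -> 'I_r.+1} | (\sum_i k i == r)%N)
    c n (minus_count m (fun i => k i)).

Definition minus_perm a (s : 'S_d) : vec := [ffun i => a i - (s i)%:Z].

Definition alternating_sum n a : K := \sum_(s : 'S_d) (-1) ^+ s * c n (minus_perm a s).

Lemma path_count_permv n m p : c n (permv m p) = c n m.
Proof.
elim: n m => [|n IHn] m.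
  rewrite !c0; congr (_%:R); congr nat_of_bool; apply/eqP/eqP => [/ffunP h|->].
    by apply/ffunP => i; have := h (p^-1%g i); rewrite !ffunE permKV.
  by apply/ffunP => i; rewrite !ffunE.
rewrite !cS.
pose perm_ffun (k : {ffun 'I_d -> 'I_r.+1}) := [ffun i => k (p i)].
have inj : injective perm_ffun.
  move=> k k' /ffunP h; apply/ffunP => i; have := h (p^-1%g i).
  by rewrite !ffunE permKV.
rewrite (reindex_inj inj) /=; apply: eq_big => [k|k _].
  congr (_ == _); rewrite [RHS](reindex_inj (@perm_inj _ p)) /=.
  by apply: eq_bigr => i _; rewrite ffunE.
by rewrite -[RHS]IHn; congr (c _ _); apply/ffunP => i; rewrite !ffunE.
Qed.

Lemma antisymmetric_alternating_sum n : antisymmetric_fun (alternating_sum n).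
Proof.
move=> a p; rewrite /alternating_sum mulr_sumr (reindex_inj (mulgI p)) /=.
apply: eq_bigr => s _; rewrite odd_permM signr_addb mulrA; congr (_ * _).
rewrite -[RHS](path_count_permv n _ p); congr (c _ _); apply/ffunP => i.
by rewrite !ffunE permM.
Qed.

(** A strictly increasing vector is [i |-> s i] for a permutation [s] only if [s] is
    the identity. *)
Lemma alternating_sum0 a : chamber a -> alternating_sum 0 a = (a == @delta d)%:R.
Proof.
move=> /chamberP ha; rewrite /alternating_sum (bigD1 (1%g : 'S_d)) //=.
rewrite odd_perm1 expr0 mul1r c0 big1 ?addr0 => [|s s1].
  congr (_%:R); congr nat_of_bool; apply/eqP/eqP => [/ffunP h|->].
    by apply/ffunP => i; have := h i; rewrite !ffunE perm1 => /eqP; rewrite subr_eq0 => /eqP.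
  by apply/ffunP => i; rewrite !ffunE perm1 subrr.
rewrite c0; case: eqP => [/ffunP h|]; last by rewrite mulr0.
case/eqP: s1; apply/permP => i; rewrite perm1; apply/val_inj.
have sa j : (s j)%:Z = a j by have := h j; rewrite !ffunE; lia.
have smono (j k : 'I_d) : (j < k)%N -> (s j < s k)%N.
  by move=> /ha; rewrite -!sa ltz_nat.
have sge n (j : 'I_d) : val j = n -> (n <= s j)%N.
  elim: n j => // n IHn j jn.
  have nd : (n < d)%N by have := ltn_ord j; rewrite -[nat_of_ord j]/(val j) jn => /ltnW.
  apply: leq_ltn_trans (IHn (Ordinal nd) erefl) (smono _ _ _).
  by rewrite -[nat_of_ord j]/(val j) jn.
(* The [s j] are at least the [j] and have the same sum. *)
have [_] := leqif_sum (fun j (_ : true) => leqif_eq (sge _ j erefl)).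
rewrite (reindex_inj (@perm_inj _ s)) eqxx => /esym/forallP/(_ i)/implyP/(_ isT)/eqP.
by [].
Qed.

Lemma alternating_sumS n a :
  alternating_sum n.+1 a = \sum_(b <- lowered r a) alternating_sum n b.
Proof.
rewrite /alternating_sum -sum_lowered exchange_big /=; apply: eq_bigr => s _.
rewrite cS mulr_sumr; apply: eq_bigr => k _; congr (_ * c _ _).
by apply/ffunP => i; rewrite !ffunE addrAC.
Qed.

Lemma alternating_sum_chains n a :
  chamber a -> alternating_sum n a = (size (chains r n a))%:R.
Proof.
elim: n a => [|n IHn] a ha.
  by rewrite alternating_sum0 //=; case: ifP.
rewrite alternating_sumS sum_lowered_interlacing //; last exact: antisymmetric_alternating_sum.
rewrite /= size_allpairs_dep sumnE big_map big_filter natr_sum.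
by apply: eq_bigr => b /interlaces_chamber/IHn.
Qed.

Fixpoint unit_walk_sum (F : vec -> K) k a : K :=
  if k is k'.+1 then \sum_i unit_walk_sum F k' (add_at a i 1) else F a.

Lemma antisymmetric_unit_walk_sum F k :
  antisymmetric_fun F -> antisymmetric_fun (unit_walk_sum F k).
Proof.
move=> antiF; elim: k => // k IHk.
exact: antisymmetric_unit_step IHk.
Qed.

Lemma unit_walk_sum_chamber F k a : antisymmetric_fun F -> chamber a ->
  unit_walk_sum F k a = walk_sum F k a.
Proof.
move=> antiF; elim: k a => // k IHk a ha /=.
rewrite (sum_unit_step (antisymmetric_unit_walk_sum k antiF)) //.
by apply: eq_bigr => i /IHk.
Qed.

Lemma walk_sum_alternating n k a : chamber a ->
  walk_sum (alternating_sum n) k a = (walk_sum (fun b => size (chains r n b)) k a)%:R.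
Proof.
elim: k a => [|k IHk] a ha /=; first exact: alternating_sum_chains.
by rewrite natr_sum; apply: eq_bigr => i /IHk.
Qed.

End AlternatingSums.

Section DeterminantPairing.
Variables (R : realType) (r d : nat) (i0 : 'I_d).
Local Notation vec := {ffun 'I_d -> int}.

Let c (n : nat) (m : vec) : R[i] := pairing (hprod R r m) (cycle_poly R r ^+ n).

Let c0 m : c 0 m = (m == [ffun=> 0])%:R.
Proof. by rewrite /c expr0 pairing_hprod1. Qed.

Let cS n m : c n.+1 m =
  \sum_(k : {ffun 'I_d -> 'I_r.+1} | (\sum_i k i == r)%N)
    c n (minus_count m (fun i => k i)).
Proof. by rewrite /c exprS (pairing_cycle_poly i0). Qed.

Lemma pairing_alternating_hwalk n k (a : vec) :
  \sum_(s : 'S_d) (-1) ^+ s * pairing (hwalk R r k (minus_perm a s)) (cycle_poly R r ^+ n) =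
  unit_walk_sum (alternating_sum c n) k a.
Proof.
elim: k a => // k IHk a /=.
under [RHS]eq_bigr do rewrite -IHk.
rewrite [RHS]exchange_big /=; apply: eq_bigr => s _.
rewrite pairing_suml mulr_sumr; apply: eq_bigr => i _.
congr (_ * pairing (hwalk _ _ _ _) _); apply/ffunP => j.
by rewrite !ffunE addrAC.
Qed.

(** The alternating sum in the Leibniz formula commutes with the walk; seen as
    a function of the position, it is antisymmetric at each step. *)
Lemma pairing_det_hwalk n k :
  \sum_(s : 'S_d) (-1) ^+ s * pairing (hwalk R r k (det_exponent s)) (cycle_poly R r ^+ n) =
  (walk_sum (fun b => size (chains r n b)) k (@delta d))%:R.
Proof.
rewrite -(walk_sum_alternating c0 cS n k (@delta_chamber d)).
rewrite -unit_walk_sum_chamber ?delta_chamber //; last exact: antisymmetric_alternating_sum.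
rewrite -pairing_alternating_hwalk; apply: eq_bigr => s _.
by congr (_ * pairing (hwalk _ _ _ _) _); apply/ffunP => i; rewrite !ffunE.
Qed.

End DeterminantPairing.

Section WalkContent.
Variables (d r : nat).
Local Notation vec := {ffun 'I_d -> int}.
Implicit Types a b : vec.

Lemma content_add_at a i l : content (add_at a i l) = content a + l.
Proof.
rewrite /content (bigD1 i) //= [in RHS](bigD1 i) //= ffunE eqxx mul1r addrAC.
by congr (_ + _ + _); apply: eq_bigr => j ji; rewrite ffunE (negPf ji) mul0r addr0.
Qed.

Lemma size_chains_eq0 n a :
  content a != content (@delta d) + (r * n)%:Z -> chains r n a = [::].
Proof.
elim: n a => [|n IHn] a /=; first by case: (a =P _) => // ->; rewrite muln0 addr0 eqxx.
move=> ha; apply/eqP; rewrite -size_eq0 size_allpairs_dep sumnE big_map big_filter.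
rewrite big_seq_cond big1 // => b /andP[]; rewrite mem_lowered => /andP[_ /eqP ab] _.
rewrite IHn //; apply: contraNneq ha => hb.
by rewrite ab hb mulnS; apply/eqP; lia.
Qed.

(** Each step up adds one box and each step down removes [r] of them, so the
    walks and the chains have no common shape unless [k = r n]. *)
Lemma walk_sum_eq0 n k a :
  content a + k%:Z != content (@delta d) + (r * n)%:Z ->
  walk_sum (fun b => size (chains r n b)) k a = 0%N.
Proof.
elim: k a => [|k IHk] a /=; first by rewrite addr0 => /size_chains_eq0 ->.
move=> ha; apply: big1 => i _; apply: IHk; rewrite content_add_at.
by apply: contraNneq ha => <-; apply/eqP; lia.
Qed.

End WalkContent.

(** * The local rule of the insertion *)

Section LocalRule.
Variable d' : nat.
Local Notation d := d'.+1.
Local Notation vec := {ffun 'I_d -> int}.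
Implicit Types a b : vec.
Implicit Types p q : 'I_d.
Local Notation "a +^ q" := (add_at a q 1) (at level 50).

Lemma add_atE a q k : (a +^ q) k = a k + (k == q)%:Z.
Proof. by rewrite ffunE mulr1. Qed.

Lemma add_at_eq a q : (a +^ q) q = a q + 1.
Proof. by rewrite add_atE eqxx. Qed.

Lemma add_at_neq a q k : k != q -> (a +^ q) k = a k.
Proof. by move=> kq; rewrite add_atE (negPf kq) addr0. Qed.

Lemma add_at_inj q a b : a +^ q = b +^ q -> a = b.
Proof.
move=> /ffunP h; apply/ffunP => i; have := h i.
by rewrite !add_atE => /addIr.
Qed.

Lemma interlaces_chamber_up b a : interlaces b a -> chamber a.
Proof.
move=> /interlacesP[h1 h2]; apply/chamberP => i j ij.
exact: lt_le_trans (h2 i j ij) (h1 j).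
Qed.

Lemma chamber_le a (i j : 'I_d) : chamber a -> (i <= j)%N -> a i <= a j.
Proof.
move=> /chamberP ha; rewrite leq_eqVlt => /orP[/eqP/val_inj -> //|/ha/ltW//].
Qed.

(** A box can be added to row [q] of [a] with [b] still interlacing [a]. *)
Definition free b a q : bool := [forall j : 'I_d, (q < j)%N ==> (a q + 1 < b j)].

(** The local rule: a box which arrives at row [p] is added to the first free
    row from [p] on.  The rows are listed from the shortest one. *)
Definition falls_to b a (p : nat) q : bool :=
  [&& (p <= q)%N, free b a q & [forall s : 'I_d, (p <= s < q)%N ==> ~~ free b a s]].

Definition fall b a (p : nat) : option 'I_d := [pick q | falls_to b a p q].

Lemma freeP b a q : reflect (forall j : 'I_d, (q < j)%N -> a q + 1 < b j) (free b a q).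
Proof.
by apply: (iffP forallP) => h j; [move=> qj; have := h j; rewrite qj|apply/implyP; exact: h].
Qed.

Lemma falls_toP b a (p : nat) q :
  reflect [/\ (p <= q)%N, free b a q & forall s : 'I_d, (p <= s < q)%N -> ~~ free b a s]
    (falls_to b a p q).
Proof.
apply: (iffP and3P) => [[h1 h2 /forallP h3]|[h1 h2 h3]]; split=> //.
  by move=> s hs; have := h3 s; rewrite hs.
by apply/forallP => s; apply/implyP; exact: h3.
Qed.

Lemma falls_to_unique b a (p : nat) q q' :
  falls_to b a p q -> falls_to b a p q' -> q = q'.
Proof.
move=> /falls_toP[pq fq hq] /falls_toP[pq' fq' hq']; apply: val_inj.
case: (ltngtP q q') => // qq'.
  by have := hq' q; rewrite pq qq' fq => /(_ isT).
by have := hq q'; rewrite pq' qq' fq' => /(_ isT).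
Qed.

Lemma fallE b a (p : nat) q : falls_to b a p q -> fall b a p = Some q.
Proof.
rewrite /fall => h; case: pickP => [q' /(falls_to_unique h) -> //|/(_ q)].
by rewrite h.
Qed.

Lemma falls_to_exists b a (p : nat) : (p < d)%N -> exists q, falls_to b a p q.
Proof.
(* The longest row is always free. *)
move=> pd; have h0 : free b a ord_max.
  by apply/freeP => j; rewrite ltnNge -ltnS ltn_ord.
have h1 : (p <= @ord_max d')%N && free b a ord_max by rewrite h0 andbT -ltnS.
case: (@arg_minnP _ _ (fun q : 'I_d => (p <= q)%N && free b a q) val h1) => q /andP[pq fq] qmin.
exists q; apply/falls_toP; split=> // s /andP[ps sq]; apply/negP => fs.
by have := qmin s; rewrite ps fs => /(_ isT); rewrite leqNgt sq.
Qed.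

(** Row [s] is blocked by the next row of [b] only, since [b] increases. *)
Lemma not_free b a (s t : 'I_d) : chamber b -> val t = s.+1 -> ~~ free b a s ->
  b t <= a s + 1.
Proof.
move=> hb ts; apply: contraNT; rewrite -ltNge => h; apply/freeP => j sj.
by apply: lt_le_trans h (chamber_le hb _); rewrite -[nat_of_ord t]/(val t) ts.
Qed.

Lemma fall_new_interlaces b a (p : nat) q :
  interlaces b a -> falls_to b a p q -> interlaces b (a +^ q).
Proof.
move=> /interlacesP[h1 h2] /falls_toP[_ /freeP fq _]; apply/interlacesP; split.
  by move=> i; rewrite add_atE; have := h1 i; lia.
move=> i j ij; rewrite add_atE; case: eqP => [e|_]; last by have := h2 _ _ ij; lia.
by subst i; exact: fq.
Qed.

(** If the box moves from [p] to a later row, then row [p] was not free, and as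
    [b +^ p] still increases strictly, [b p + 1] is at most [a p]. *)
Lemma fall_interlaces b a p q :
  interlaces b a -> chamber (b +^ p) -> falls_to b a p q ->
  interlaces (b +^ p) (a +^ q).
Proof.
move=> ba /chamberP bp fpq; have /interlacesP[h1 h2] := fall_new_interlaces ba fpq.
have /interlacesP[h3 _] := ba.
apply/interlacesP; split=> [i|i j ij]; last first.
  by have := h2 _ _ ij; rewrite [(b +^ p) j]add_atE; lia.
rewrite [(b +^ p) i]add_atE; case: (i =P p) => [->|_]; last by have := h1 i; lia.
have [-> |pq] := eqVneq p q; first by rewrite add_at_eq; have := h3 q; lia.
rewrite add_at_neq //; have /falls_toP[le_pq _ hs] := fpq.
have lt_pq : (p < q)%N by rewrite ltn_neqAle le_pq andbT.
have p1d : (p.+1 < d)%N := leq_ltn_trans lt_pq (ltn_ord q).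
have := not_free (interlaces_chamber ba) (erefl : val (Ordinal p1d) = p.+1)
  (hs p _); rewrite leqnn lt_pq => /(_ isT).
have := bp p (Ordinal p1d) (leqnn _); rewrite add_at_eq add_at_neq; first by lia.
by rewrite -val_eqE /= gtn_eqF.
Qed.

(** The rule is onto.  To undo it, look for the last row [p] up to [q] from which
    a box can be removed in [b'] so that it still interlaces [a]; if there is none,
    the box was created at this level and fell from the first row. *)
Lemma fall_back b' a q : (forall i, 0 <= b' i) -> chamber a -> 0 <= a ord0 ->
  interlaces b' (a +^ q) ->
  (exists p b, [/\ b' = b +^ p, (forall i, 0 <= b i), interlaces b a & falls_to b a p q]) \/
  [/\ b' ord0 = 0, interlaces b' a & falls_to b' a 0 q].
Proof.
move=> b'0 ha a0 b'a; have /chamberP hb' := interlaces_chamber b'a.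
have /interlacesP[h1 h2] := b'a.
(* [back p]: lowering [b' p] keeps it nonnegative and above the earlier rows
   of [a]. *)
pose back p := (0 < b' p) && [forall i : 'I_d, (i < p)%N ==> (a i + 1 < b' p)].
have aq (i : 'I_d) : (i < q)%N -> (a +^ q) i = a i.
  by move=> iq; rewrite add_at_neq // -val_eqE ltn_eqF.
have age0 (i : 'I_d) : 0 <= a i by apply: le_trans a0 (chamber_le ha _).
have not_back p : ~~ back p -> b' p <= 0 \/ exists2 i : 'I_d, (i < p)%N & b' p <= a i + 1.
  rewrite negb_and -leNgt => /orP[h|/forallPn[l]]; first by left.
  by rewrite negb_imply -leNgt => /andP[? ?]; right; exists l.
have le_q : ~~ back q -> b' q <= a q.
  move=> /not_back[h|[i iq h]]; first exact: le_trans h (age0 q).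
  by have /chamberP/(_ _ _ iq) := ha; lia.
have free_q b : (forall j : 'I_d, (q < j)%N -> b j = b' j) -> free b a q.
  by move=> bb; apply/freeP => j qj; rewrite bb // -add_at_eq; exact: h2.
have not_free_s b (s : 'I_d) : (s < q)%N ->
    (forall t : 'I_d, val t = s.+1 -> ~~ back t /\ b t = b' t) -> ~~ free b a s.
  move=> sq ht; have s1d : (s.+1 < d)%N := leq_ltn_trans sq (ltn_ord q).
  have [nb bt] := ht (Ordinal s1d) erefl.
  apply/negP => /freeP/(_ (Ordinal s1d) (leqnn _)); rewrite bt.
  have := h2 s (Ordinal s1d) (leqnn _); rewrite aq //; have := age0 s.
  case: (not_back _ nb) => [|[l]]; first by lia.
  by rewrite ltnS => /(chamber_le ha); lia.
have [/existsP[p0 hp0]|/existsPn none] := boolP [exists p : 'I_d, (p <= q)%N && back p].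
  case: (@arg_maxnP _ _ (fun p : 'I_d => (p <= q)%N && back p) val hp0) => p.
  move=> /andP[pq /andP[bp /forallP pmin]] pmax.
  have {}pmin (i : 'I_d) : (i < p)%N -> a i + 1 < b' p.
    by move=> ip; have := pmin i; rewrite ip.
  have {}pmax (s : 'I_d) : (p < s <= q)%N -> ~~ back s.
    by move=> /andP[ps sq]; apply/negP => bs; have := pmax s; rewrite sq bs /= leqNgt ps => /(_ isT).
  left; exists p; exists (add_at b' p (-1)).
  have bE k : add_at b' p (-1) k = b' k - (k == p)%:Z by rewrite ffunE mulrN1.
  split.
  - by apply/ffunP => i; rewrite add_atE bE subrK.
  - by move=> i; rewrite bE; case: eqP => [->|_]; [lia|rewrite subr0].
  - apply/interlacesP; split=> [i|i j ij]; rewrite bE.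
      have [->|iq] := eqVneq i q; last first.
        by have := h1 i; rewrite add_at_neq //; lia.
      have [-> |qp] := eqVneq q p; first by have := h1 p; rewrite add_atE; lia.
      have lt_pq : (p < q)%N by rewrite ltn_neqAle pq andbT eq_sym.
      by have := le_q (pmax q _); rewrite leqnn lt_pq => /(_ isT); lia.
    case: (j =P p) => [jp|_]; first by subst j; have := pmin _ ij; lia.
    by have := h2 _ _ ij; rewrite add_atE; lia.
  - apply/falls_toP; split=> //.
      apply: free_q => j qj; rewrite bE -val_eqE gtn_eqF ?subr0 //.
      exact: leq_ltn_trans pq qj.
    move=> s /andP[ps sq]; apply: not_free_s => // t ts; split.
      by apply: pmax; rewrite -[nat_of_ord t]/(val t) ts ltnS ps.
    by rewrite bE -val_eqE ts gtn_eqF ?subr0 // ltnS.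
have {}none (s : 'I_d) : (s <= q)%N -> ~~ back s.
  by move=> sq; have := none s; rewrite sq.
right; split.
- have := b'0 ord0; case: (not_back _ (none ord0 (leq0n _))) => [|[l]] //.
  by move=> h1' h2'; apply/eqP; rewrite eq_le h1' h2'.
- apply/interlacesP; split=> [i|i j ij]; last by have := h2 _ _ ij; rewrite add_atE; lia.
  have [->|iq] := eqVneq i q; first exact/le_q/none.
  by have := h1 i; rewrite add_at_neq.
- apply/falls_toP; split=> //; first exact: free_q.
  move=> s /= sq; apply: not_free_s => // t ts; split=> //; apply: none.
  by rewrite -[nat_of_ord t]/(val t) ts.
Qed.

(** If [p < p2], the row just before [p2] is not free for [b], because of the entry
    of [b] at [p2]; that entry is the one of [b2 +^ p2], which is larger than the one
    of [b2], and this contradicts the interlacing of [b2] with [a]. *)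
Lemma fall_inj b a p q b2 p2 : interlaces b a -> interlaces b2 a ->
  falls_to b a p q -> falls_to b2 a p2 q -> b +^ p = b2 +^ p2 -> p = p2.
Proof.
wlog le_pp : b p b2 p2 / (p <= p2)%N.
  move=> hw h1 h2 h3 h4 e; case: (leqP p p2) => [h|/ltnW h].
    exact: (hw _ _ _ _ h h1 h2 h3 h4 e).
  exact/esym/(hw _ _ _ _ h h2 h1 h4 h3 (esym e)).
move=> ba b2a /falls_toP[_ _ hs] /falls_toP[p2q _ _] e; apply: val_inj.
move: le_pp; rewrite leq_eqVlt => /orP[/eqP //|lt_pp].
have s_d : (p2.-1 < d)%N := leq_ltn_trans (leq_pred _) (ltn_ord p2).
have p2E : val p2 = (Ordinal s_d).+1 by rewrite /= prednK // (leq_ltn_trans _ lt_pp).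
have lt_s : (Ordinal s_d < p2)%N by rewrite [X in (_ < X)%N]p2E.
have := not_free (interlaces_chamber ba) p2E (hs _ _).
have -> : (p <= Ordinal s_d < q)%N.
  by rewrite (leq_trans lt_s p2q) andbT -ltnS -p2E.
move=> /(_ isT).
have /interlacesP[_ /(_ _ _ lt_s)] := b2a.
move: e => /ffunP/(_ p2); rewrite add_at_eq add_at_neq; first by lia.
by rewrite -val_eqE gtn_eqF.
Qed.

(** A box that comes from the level below is not mistaken for a new one: a new
    one would have stopped at the row before [p]. *)
Lemma fall_new_disjoint b a p q : (forall i, 0 <= b i) -> interlaces b a ->
  (b +^ p) ord0 = 0 -> interlaces (b +^ p) a ->
  falls_to b a p q -> falls_to (b +^ p) a 0 q -> False.
Proof.
move=> b0 ba bp0 bpa /falls_toP[pq _ _] /falls_toP[_ _ hs].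
have [p0|p0] := eqVneq p ord0.
  by move: bp0; rewrite p0 add_at_eq; have := b0 ord0; lia.
have p_gt0 : (0 < p)%N by rewrite lt0n.
have s_d : (p.-1 < d)%N := leq_ltn_trans (leq_pred _) (ltn_ord p).
have pE : val p = (Ordinal s_d).+1 by rewrite /= prednK.
have lt_s : (Ordinal s_d < p)%N by rewrite [X in (_ < X)%N]pE.
have := not_free (interlaces_chamber bpa) pE (hs _ _).
rewrite (leq_trans lt_s pq) => /(_ isT); rewrite add_at_eq.
by have /interlacesP[_ /(_ _ _ lt_s)] := ba; lia.
Qed.

(** The shape [b] has at least [d - i - 1] nonempty rows: row [k] of the shape
    encoded by [b] is nonempty when [k < b k], and the last index gives no
    condition. *)
Definition reach b (i : 'I_d) : bool := [forall k : 'I_d, (val k == i.+1) ==> (k%:Z < b k)].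

Lemma chamber_ge a (i : 'I_d) : chamber a -> 0 <= a ord0 -> i%:Z <= a i.
Proof.
move=> ha a0; case: i => n; elim: n => [|n IHn] nd.
  by rewrite (_ : Ordinal nd = ord0) //; apply: val_inj.
have := IHn (ltnW nd); have /chamberP/(_ (Ordinal (ltnW nd)) (Ordinal nd) (leqnn _)) := ha.
by rewrite /=; lia.
Qed.

(** The rows of a shape increase along the indices, so a nonempty row is
    followed by nonempty rows. *)
Lemma chamber_gap a (i j : 'I_d) : chamber a -> (i <= j)%N -> i%:Z < a i -> j%:Z < a j.
Proof.
move=> ha; case: j => n; elim: n => [|n IHn] nd /=.
  by rewrite leqn0 => /eqP i0; rewrite (_ : i = Ordinal nd) //; apply: val_inj.
rewrite leq_eqVlt => /orP[/eqP iE|].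
  by rewrite (_ : i = Ordinal nd) //; apply: val_inj.
rewrite ltnS => /IHn h /(h (ltnW nd)).
have /chamberP/(_ (Ordinal (ltnW nd)) (Ordinal nd) (leqnn _)) := ha.
by rewrite /=; lia.
Qed.

(** A new box cannot stop before the last row which is empty in [b].  If that row
    is empty in [a] too, it is free, and the box makes it nonempty; otherwise the
    box lands in a row which is already nonempty. *)
Lemma new_row b a q (i : 'I_d) : 0 <= a ord0 -> interlaces b a -> falls_to b a 0 q ->
  (i%:Z < (a +^ q) i) = (i%:Z < a i) || reach b i.
Proof.
move=> a0 ba /falls_toP[_ /freeP fq hs].
have hb := interlaces_chamber ba; have ha := interlaces_chamber_up ba.
have /interlacesP[h1 h2] := ba.
have reach_q : reach b q.
  apply/forallP => k; apply/implyP => /eqP kE; have := fq k; rewrite -[nat_of_ord k]/(val k) kE.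
  by move=> /(_ (leqnn _)); have := chamber_ge q ha a0; lia.
rewrite add_atE; have [->|iq] := eqVneq i q.
  by rewrite reach_q orbT; have := chamber_ge q ha a0; lia.
rewrite addr0; case: ltP => //= ai; apply/esym/negP => /forallP ri.
have fi : free b a i.
  apply/freeP => j ij; have i1d : (i.+1 < d)%N := leq_ltn_trans ij (ltn_ord j).
  have /implyP/(_ (eqxx _)) := ri (Ordinal i1d).
  by have := chamber_le (i := Ordinal i1d) hb ij; rewrite /=; lia.
have qi : (q < i)%N.
  rewrite ltn_neqAle val_eqE eq_sym iq /= leqNgt; apply/negP => lt_iq.
  by have := hs i; rewrite lt_iq fi => /(_ isT).
have q1d : (q.+1 < d)%N := leq_ltn_trans qi (ltn_ord i).
have /forallP/(_ (Ordinal q1d))/implyP/(_ (eqxx _)) := reach_q.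
by move=> /(chamber_gap (i := Ordinal q1d) hb qi); have := h1 i; lia.
Qed.

(** The box starts a new row of [a] only if it starts the same row of [b]: if
    [p < q], then row [p + 1] of [b] is nonempty since [b +^ p] increases, so row [q]
    is nonempty in [b] and in [a].  Conversely, if the box starts row [p] of [b] and
    that row is empty in [a], then it is free and the box stays there. *)
Lemma moved_row b a p q (i : 'I_d) (R : pred 'I_d) : 0 <= b ord0 -> 0 <= a ord0 ->
  interlaces b a -> chamber (b +^ p) -> falls_to b a p q ->
  (forall k : 'I_d, (k%:Z < (b +^ p) k) = (k%:Z < b k) || R k) ->
  (i%:Z < (a +^ q) i) = (i%:Z < a i) || R i.
Proof.
move=> b0 a0 ba /chamberP bp /falls_toP[pq /freeP fq hs] hR.
have hb := interlaces_chamber ba; have ha := interlaces_chamber_up ba.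
have /interlacesP[h1 h2] := ba.
rewrite add_atE; have [->|iq] := eqVneq i q.
  have [aq|aq] := ltP q%:Z (a q); first by lia.
  have bq : b q = q%:Z by have := chamber_ge q hb b0; have := h1 q; lia.
  have [qp|qp] := eqVneq q p.
    by subst q; have := hR p; rewrite add_at_eq bq ltxx /= => <-; have := h1 p; lia.
  have lt_pq : (p < q)%N by rewrite ltn_neqAle pq andbT eq_sym.
  have p1d : (p.+1 < d)%N := leq_ltn_trans lt_pq (ltn_ord q).
  have := bp p (Ordinal p1d) (leqnn _); rewrite add_at_eq add_at_neq; last first.
    by rewrite -val_eqE /= gtn_eqF.
  have := chamber_ge p hb b0; move=> h3 h4.
  have := chamber_gap (i := Ordinal p1d) hb lt_pq; rewrite bq ltxx /=; lia.
rewrite addr0; case: ltP => //= ai; apply/esym/negP => Ri.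
have := hR i; rewrite Ri orbT add_atE; have := h1 i; case: (i =P p) => [ip|_]; last by lia.
move=> bi h5; subst i.
have /negP[] : ~~ free b a p by apply: hs; rewrite leqnn ltn_neqAle pq andbT.
apply/freeP => j pj; have := bp _ _ pj.
rewrite add_at_eq add_at_neq -?val_eqE ?gtn_eqF //; lia.
Qed.

End LocalRule.

(** * Insertion of a letter into a semistandard tableau *)

Section Insertion.
Variable d' : nat.
Local Notation d := d'.+1.
Local Notation vec := {ffun 'I_d -> int}.
Implicit Types (a b : vec) (P : seq vec) (p q : 'I_d).
Local Notation "a +^ q" := (add_at a q 1) (at level 50).
Local Notation delta := (@delta d).

(** Chains are listed from the largest shape to the empty one. *)
Fixpoint is_chain P : bool :=
  if P is a :: P1 then
    if P1 is b :: _ then interlaces b a && is_chain P1 else a == delta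
  else false.

(** Insertion of the letter [x]: a box is created at the level of [x] and pushed
    up through the levels of the larger letters by the local rule.  The result also
    records the row of the box at the top.  Insertion fails when the [d] rows of the
    shape formed by the smaller letters are nonempty: one more row would be needed. *)
Fixpoint insert P (x : nat) : option (seq vec * 'I_d) :=
  if P is a :: P1 then
    if P1 is b :: P2 then
      if x == size P2 then
        if b ord0 == 0 then omap (fun q => (a +^ q :: P1, q)) (fall b a 0) else None
      else if insert P1 x is Some (P1', p) then
        omap (fun q => (a +^ q :: P1', q)) (fall b a p)
      else None
    else None
  else None.

Definition top P : vec := head delta P.

Lemma is_chain_ge0 P i : is_chain P -> 0 <= top P i.
Proof.
elim: P => // a [_ /eqP ->|b P1] /=; first by rewrite ffunE.
by move=> IH /andP[/interlacesP[h _] /IH]; have := h i; rewrite /=; lia.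
Qed.

Lemma is_chain_consP a b P : is_chain (a :: b :: P) ->
  [/\ interlaces b a, is_chain (b :: P) & forall i, 0 <= b i].
Proof. by move=> /andP[ba cP]; split=> // i; exact: (@is_chain_ge0 (b :: P) i cP). Qed.

Lemma is_chain_chamber P : is_chain P -> chamber (top P).
Proof.
case: P => // a [|b P1] /=; first by move=> /eqP ->; exact: delta_chamber.
by move=> /andP[/interlaces_chamber_up].
Qed.

Lemma insert_consE a b P2 x : insert (a :: b :: P2) x =
  if x == size P2 then
    if b ord0 == 0 then omap (fun q => (a +^ q :: b :: P2, q)) (fall b a 0) else None
  else if insert (b :: P2) x is Some (P1', p) then
    omap (fun q => (a +^ q :: P1', q)) (fall b a p)
  else None.
Proof. by []. Qed.

Variant insert_spec a b P2 x : option (seq vec * 'I_d) -> Prop :=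
| InsertNew q of x = size P2 & b ord0 = 0 & falls_to b a 0 q :
    insert_spec a b P2 x (Some (a +^ q :: b :: P2, q))
| InsertOld p q P1' of x != size P2 & insert (b :: P2) x = Some (P1', p) & falls_to b a p q :
    insert_spec a b P2 x (Some (a +^ q :: P1', q))
| InsertFailNew of x = size P2 & b ord0 != 0 : insert_spec a b P2 x None
| InsertFailOld of x != size P2 & insert (b :: P2) x = None : insert_spec a b P2 x None.

Lemma insertP a b P2 x : insert_spec a b P2 x (insert (a :: b :: P2) x).
Proof.
rewrite insert_consE; case: eqP => [xs|/eqP xs].
  case: eqP => [b0|/eqP b0]; last exact: InsertFailNew.
  have [q hq] := falls_to_exists b a (ltn0Sn d').
  by rewrite (fallE hq) /=; apply: InsertNew.
case E: (insert (b :: P2) x) => [[P1' p]|]; last exact: InsertFailOld.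
have [q hq] := falls_to_exists b a (ltn_ord p).
by rewrite (fallE hq) /=; apply: InsertOld E hq.
Qed.

Lemma insert_shape P x P' q : insert P x = Some (P', q) ->
  size P' = size P /\ top P' = top P +^ q.
Proof.
elim: P P' q => // a [//|b P2] IHP P' q.
case: insertP => // [q' _ _ _ [<- <-]|p q' P1' _ hi _ [<- <-]] //=.
by have [] := IHP _ _ hi; rewrite /= => ->.
Qed.

Lemma insert_is_chain P x P' q : is_chain P -> insert P x = Some (P', q) -> is_chain P'.
Proof.
elim: P P' q => // a [//|b P2] IHP P' q /andP[ba cP].
case: insertP => // [q' _ _ hq [<- _]|p q' P1' _ hi hq [<- _]].
  by rewrite /= (fall_new_interlaces ba hq).
have cP1 := IHP _ _ cP hi; have [sz tp] := insert_shape hi.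
case: P1' hi cP1 sz tp => // b' P1' hi cP1 sz /= tp; apply/andP; split=> //.
rewrite tp; apply: fall_interlaces => //=.
by rewrite -[_ +^ _]tp; exact: is_chain_chamber cP1.
Qed.

Lemma insert_lt_size P x P' q : insert P x = Some (P', q) -> (x < (size P).-1)%N.
Proof.
elim: P P' q => // a [//|b P2] IHP P' q.
case: insertP => // [q' -> //|p q' P1' _ hi _ _].
by have := IHP _ _ hi; rewrite /=; lia.
Qed.

(** Going down from the top, the local rule determines the previous shape and
    whether the box was created at this level. *)
Lemma insert_inj P x P2 x2 P' q : is_chain P -> is_chain P2 ->
  insert P x = Some (P', q) -> insert P2 x2 = Some (P', q) -> P = P2 /\ x = x2.
Proof.
elim: P P2 P' q => // a [//|b P1] IHP [|a2 [|b2 P12]] // P' q.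
move=> /is_chain_consP[ba cP b0] /is_chain_consP[ba2 cP2 b20].
case: insertP => // [q1 xs b00 h1 [<- <-]|p1 q1 P1' xs hi h1 [<- <-]];
case: insertP => // [q2 xs2 b200 h2|p2 q2 P12' xs2 hi2 h2].
- move=> [e eb eP eq]; subst q2; have ea := add_at_inj e; subst a2 b2 P12.
  by rewrite xs xs2.
- move=> [e eP eq]; subst q2; have ea := add_at_inj e; subst a2.
  have [_ tp] := insert_shape hi2; rewrite eP /= in tp.
  by exfalso; apply: (fall_new_disjoint b20 ba2 _ _ h2); rewrite -tp.
- move=> [e eP eq]; subst q2; have ea := add_at_inj e; subst a2.
  have [_ tp] := insert_shape hi; rewrite -eP /= in tp.
  by exfalso; apply: (fall_new_disjoint b0 ba _ _ h1); rewrite -tp.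
- move=> [e eP eq]; subst q2 P12'; have ea := add_at_inj e; subst a2.
  have [_ tp] := insert_shape hi; have [_ tp2] := insert_shape hi2.
  have ep : p1 = p2.
    by apply: fall_inj ba ba2 h1 h2 _; rewrite -[b +^ p1]tp -[b2 +^ p2]tp2.
  by subst p2; have [-> ->] := IHP _ _ _ cP cP2 hi hi2.
Qed.

Lemma insert_surj P' q a : is_chain P' -> top P' = a +^ q -> chamber a -> 0 <= a ord0 ->
  exists P x, [/\ is_chain P, top P = a & insert P x = Some (P', q)].
Proof.
elim: P' q a => // a' [|b' P2] IHP q a.
  move=> /eqP ->{a' IHP} /= e ha a0; exfalso.
  have := chamber_ge q ha a0; have /ffunP/(_ q) := e.
  by rewrite add_at_eq ffunE; lia.
move=> /is_chain_consP[ba cP b'0] /= e ha a0; subst a'.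
case: (fall_back b'0 ha a0 ba) => [[p [b [eb b0 ba2 hf]]]|[b00 ba2 hf]]; last first.
  exists (a :: b' :: P2), (size P2); split; rewrite /= ?ba2 //.
  by rewrite eqxx b00 eqxx (fallE hf).
have [P1 [x [cP1 tp hi]]] := IHP p b cP eb (interlaces_chamber ba2) (b0 ord0).
case: P1 cP1 tp hi => // b1 P1 cP1 tp hi; rewrite /top /= in tp; subst b1.
exists (a :: b :: P1), x; split; rewrite ?insert_consE //; first by apply/andP.
have lt_x : (x < size P1)%N := insert_lt_size hi.
by rewrite ltn_eqF // hi (fallE hf).
Qed.

(** For the tableau of a word, the shape of the subword of letters below [j]. *)
Definition level P (j : nat) : vec := nth delta (rev P) j.

Lemma level_cons a P j : level (a :: P) j =
  if (j < size P)%N then level P j else if j == size P then a else delta.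
Proof. by rewrite /level rev_cons nth_rcons size_rev. Qed.

Lemma insert_level_content P x P' q j : insert P x = Some (P', q) -> (j < size P)%N ->
  content (level P' j) = content (level P j) + (x < j)%N%:Z.
Proof.
elim: P P' q j => // a [//|b P2] IHP P' q j.
case: insertP => // [q' xs _ _ [<- _]|p q' P1' xs hi _ [<- _]] lt_j.
  rewrite !(level_cons _ (b :: P2)); move: lt_j; rewrite /= ltnS leq_eqVlt.
  case: eqP => [->|_] /= lt_j; first by rewrite ltnn content_add_at xs leqnn.
  by rewrite lt_j xs ltnNge -ltnS lt_j addr0.
have [sz _] := insert_shape hi; have lt_x := insert_lt_size hi.
rewrite (level_cons _ P1') (level_cons _ (b :: P2)) sz.
have : (j <= size (b :: P2))%N by [].
rewrite leq_eqVlt => /orP[/eqP -> |lt_j']; last by rewrite lt_j' (IHP _ _ _ hi).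
by rewrite ltnn eqxx content_add_at (leq_trans lt_x).
Qed.

Lemma insert_level_rows P x P' q j (i : 'I_d) : is_chain P ->
  insert P x = Some (P', q) -> (j < size P)%N ->
  (i%:Z < level P' j i) = (i%:Z < level P j i) || ((x < j)%N && reach (level P x) i).
Proof.
elim: P P' q j i => // a [//|b P2] IHP P' q j i cP.
have a0 := is_chain_ge0 ord0 cP.
case/is_chain_consP: cP => ba cP /(_ ord0) b0.
case: insertP => // [q' xs b00 hq [<- _]|p q' P1' xs hi hq [<- _]] lt_j.
  rewrite !(level_cons _ (b :: P2)); move: lt_j; rewrite /= ltnS leq_eqVlt.
  have lx : level [:: b & P2] x = b by rewrite xs level_cons ltnn eqxx.
  rewrite xs ltnSn -xs lx; case: eqP => [->|_] /= lt_j.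
    by rewrite ltnn xs ltnSn /=; exact: new_row hq.
  by rewrite lt_j (ltnNge x) -ltnS lt_j orbF.
have [sz tp] := insert_shape hi; have lt_x := insert_lt_size hi.
rewrite (level_cons _ P1') !(level_cons _ (b :: P2)) sz.
have -> : (x < size (b :: P2))%N by rewrite (leq_trans lt_x).
have : (j <= size (b :: P2))%N by [].
rewrite leq_eqVlt => /orP[/eqP -> |lt_j']; last by rewrite lt_j' (IHP _ _ _ _ cP hi).
rewrite ltnn eqxx.
have cP1 := insert_is_chain cP hi.
have lvl (Q : seq vec) c : level (c :: Q) (size Q) = c.
  by rewrite level_cons ltnn eqxx.
have cb : chamber (b +^ p) by have := is_chain_chamber cP1; rewrite tp.
have -> : (x < (size P2).+1)%N by rewrite (leq_trans lt_x).
rewrite andTb; apply: (@moved_row _ _ _ _ _ _ (reach (level (b :: P2) x)) b0 a0 ba cb hq) => k.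
have := IHP _ _ (size P2) k cP hi (leqnn _).
case: P1' sz tp {hi cP1} => // b1 Q /= [sz] ->.
by rewrite -{1}sz !lvl lt_x.
Qed.

(** The local rule never fails, so only the creation of the box can. *)
Lemma insert_None P x : is_chain P -> (x < (size P).-1)%N ->
  (insert P x == None) = (0 < level P x ord0).
Proof.
elim: P => // a [//|b P2] IHP cP lt_x.
have -> : level (a :: b :: P2) x = level (b :: P2) x by rewrite level_cons lt_x.
case/is_chain_consP: cP => ba cP /(_ ord0) b0.
have lvl : level (b :: P2) (size P2) = b by rewrite level_cons ltnn eqxx.
case: insertP => [q xs b00 _|p q P1' xs hi _|xs b00|xs hi].
- by rewrite xs lvl b00.
- have := IHP cP; rewrite hi; apply; move: lt_x xs; rewrite /=; lia.
- by rewrite xs lvl lt_def b00.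
- have := IHP cP; rewrite hi; apply; move: lt_x xs; rewrite /=; lia.
Qed.

End Insertion.

(** * Increasing subsequences *)

Section IncreasingSubsequences.

(** Strictly increasing subsequences of length [k] with letters below [j]: the
    bound makes the recursion on the last letter possible. *)
Definition has_increasing (w : seq nat) (j k : nat) : Prop :=
  exists s, [/\ subseq s w, sorted ltn s, size s = k & all (ltn^~ j) s].

Lemma subseq_rconsP (T : eqType) (s w : seq T) x : subseq s (rcons w x) ->
  subseq s w \/ exists2 s', s = rcons s' x & subseq s' w.
Proof.
rewrite -subseq_rev rev_rcons; case E: (rev s) => [|y t] /=.
  by left; rewrite -subseq_rev E sub0seq.
case: eqP => [yx|_] h; last by left; rewrite -subseq_rev E.
right; exists (rev t); last by rewrite -subseq_rev revK.
by rewrite -(revK s) E rev_cons yx.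
Qed.

Lemma has_increasing_rcons w x j k : has_increasing (rcons w x) j k <->
  has_increasing w j k \/ [/\ (x < j)%N, (0 < k)%N & has_increasing w x k.-1].
Proof.
split=> [[s [sw ss sk sj]]|[[s [sw ss sk sj]]|[xj k0 [s [sw ss sk sx]]]]].
- case: (subseq_rconsP sw) => [sw'|[s' e s'w]]; first by left; exists s.
  right; move: ss sj sk; rewrite e (sorted_pairwise ltn_trans) pairwise_rcons.
  rewrite all_rcons size_rcons => /andP[s'x ss] /andP[xj _] <-; split=> //.
  by exists s'; split=> //; rewrite sorted_pairwise //; exact: ltn_trans.
- exists s; split=> //; exact: subseq_trans sw (subseq_rcons _ _).
- exists (rcons s x); split.
  + by rewrite -!cats1; apply: cat_subseq.
  + rewrite (sorted_pairwise ltn_trans) pairwise_rcons sx.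
    by rewrite -(sorted_pairwise ltn_trans).
  + by rewrite size_rcons sk prednK.
  + rewrite all_rcons; apply/andP; split=> //; apply: sub_all sx => y /= yx.
    exact: ltn_trans yx xj.
Qed.

Lemma has_increasing0 w j : has_increasing w j 0.
Proof. by exists [::]; rewrite sub0seq. Qed.

Lemma has_increasing_nil j k : has_increasing [::] j k -> k = 0%N.
Proof. by move=> [s [/eqP ->]]. Qed.

End IncreasingSubsequences.

(** * The correspondence between words and pairs of tableaux *)

Section WordBijection.
Variable d' : nat.
Local Notation d := d'.+1.
Local Notation vec := {ffun 'I_d -> int}.
Implicit Types (a b : vec) (P : seq vec) (Q : seq 'I_d) (w : seq nat).
Local Notation "a +^ q" := (add_at a q 1) (at level 50).
Local Notation delta := (@delta d).

Definition walk_end a Q : vec := foldl (fun a q => a +^ q) a Q.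

Fixpoint is_walk a Q : bool :=
  if Q is q :: Q1 then chamber (a +^ q) && is_walk (a +^ q) Q1 else true.

Lemma is_walk_rcons a Q q :
  is_walk a (rcons Q q) = is_walk a Q && chamber (walk_end a Q +^ q).
Proof. by elim: Q a => [|p Q IHQ] a /=; rewrite ?andbT // IHQ andbA. Qed.

Lemma walk_end_rcons a Q q : walk_end a (rcons Q q) = walk_end a Q +^ q.
Proof. exact: foldl_rcons. Qed.

Lemma walk_end_ge a Q i : a i <= walk_end a Q i.
Proof.
elim/last_ind: Q => // Q q IHQ; rewrite walk_end_rcons add_atE.
by apply: le_trans IHQ _; lia.
Qed.

Lemma walk_end_chamber a Q : chamber a -> is_walk a Q -> chamber (walk_end a Q).
Proof.
case/lastP: Q => // Q q ha; rewrite is_walk_rcons walk_end_rcons.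
by move=> /andP[].
Qed.

Definition rsk_step (st : option (seq vec * seq 'I_d)) (x : nat) :=
  if st is Some (P, Q) then
    omap (fun Pq : seq vec * 'I_d => (Pq.1, rcons Q Pq.2)) (insert P x)
  else None.

Definition rsk (n : nat) w : option (seq vec * seq 'I_d) :=
  foldl rsk_step (Some (nseq n.+1 delta, [::])) w.

Lemma rsk_rcons n w x : rsk n (rcons w x) = rsk_step (rsk n w) x.
Proof. exact: foldl_rcons. Qed.

Lemma level_nseq n j : level (nseq n delta) j = delta.
Proof.
by elim: n => [|n IHn]; rewrite ?level_cons; [rewrite /level nth_nil|rewrite IHn !if_same].
Qed.

Lemma interlaces_refl a : chamber a -> interlaces a a.
Proof. by move=> /chamberP h; apply/interlacesP; split. Qed.

Lemma is_chain_nseq n : is_chain (nseq n.+1 delta).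
Proof.
elim: n => [|n IHn] /=; first by rewrite eqxx.
by rewrite interlaces_refl //; exact: delta_chamber.
Qed.

(** Schensted's theorem, for the subwords of letters below [j]: row [i] of the
    shape is nonempty exactly when the subword has a strictly increasing
    subsequence of length [d - i]; rows are listed from the shortest one. *)
Record rsk_inv n w P Q : Prop := RskInv {
  inv_chain : is_chain P;
  inv_size : size P = n.+1;
  inv_top : top P = walk_end delta Q;
  inv_walk : is_walk delta Q;
  inv_sizeQ : size Q = size w;
  inv_content : forall j, (j <= n)%N ->
    content (level P j) = content delta + (count (ltn^~ j) w)%:Z;
  inv_rows : forall j (i : 'I_d), (j <= n)%N ->
    (i%:Z < level P j i) <-> has_increasing w j (d - i) }.

(** The rows to be filled below the letter [x], in terms of the subsequences to
    which [x] can be appended. *)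
Lemma reach_has_increasing n w P Q x i : rsk_inv n w P Q -> (x < n)%N ->
  reach (level P x) i <-> has_increasing w x (d - i).-1.
Proof.
move=> inv xn; have [i1d|] := ltnP i.+1 d; last first.
  move=> le_d; have -> : (d - i).-1 = 0%N by move: le_d; lia.
  split=> _; first exact: has_increasing0.
  by apply/forallP => k; apply/implyP => /eqP kE; have := ltn_ord k; move: kE le_d => /= ->; lia.
have := inv_rows inv (Ordinal i1d) (ltnW xn).
rewrite /= subnS => <-; split=> [/forallP/(_ (Ordinal i1d))/implyP|h].
  by apply; rewrite eqxx.
apply/forallP => k; apply/implyP => kE.
by have -> : k = Ordinal i1d by apply: val_inj; exact/eqP.
Qed.

Lemma rsk_invP n w P Q : all (ltn^~ n) w -> rsk n w = Some (P, Q) -> rsk_inv n w P Q.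
Proof.
elim/last_ind: w P Q => [|w x IHw] P Q.
  move=> _ [<- <-]; split=> //.
  - exact: is_chain_nseq.
  - by rewrite /= size_nseq.
  - by move=> j _; rewrite (level_nseq n.+1) addr0.
  - move=> j i _; rewrite (level_nseq n.+1) ffunE ltxx; split=> // /has_increasing_nil.
    by have := ltn_ord i; lia.
rewrite all_rcons => /andP[/= xn aw]; rewrite rsk_rcons.
case E: (rsk n w) => [[P0 Q0]|] //=; case F: (insert P0 x) => [[P' q]|] //= [<- <-].
have inv := IHw _ _ aw E; have [cP sP tP wQ sQ ctP clP] := inv.
have [sP' tP'] := insert_shape F; have cP' := insert_is_chain cP F.
split=> //.
- by rewrite sP'.
- by rewrite tP' tP walk_end_rcons.
- by rewrite is_walk_rcons wQ -tP -tP' is_chain_chamber.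
- by rewrite !size_rcons sQ.
- move=> j jn; rewrite (insert_level_content F) ?sP // ctP // -cats1 count_cat /=.
  by rewrite addn0 PoszD addrA.
- move=> j i jn; rewrite (insert_level_rows _ cP F) ?sP //.
  rewrite has_increasing_rcons subn_gt0 ltn_ord -clP //.
  split=> [/orP[->|/andP[xj /(reach_has_increasing _ inv xn) h]]|]; [by left|by right|].
  by move=> [->//|[xj _ /(reach_has_increasing _ inv xn) h]]; rewrite xj h orbT.
Qed.

Lemma rsk_None n w : all (ltn^~ n) w -> rsk n w = None <-> has_increasing w n d.+1.
Proof.
elim/last_ind: w => [|w x IHw]; first by split=> // /has_increasing_nil.
rewrite all_rcons => /andP[/= xn aw]; rewrite rsk_rcons has_increasing_rcons /=.
case E: (rsk n w) => [[P Q]|] /=; last first.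
  by split=> // _; left; apply/IHw.
have inv := rsk_invP aw E; have := inv_rows inv ord0 (ltnW xn).
rewrite subn0 => h.
have hN : ~ has_increasing w n d.+1 by move=> /(IHw aw); rewrite E.
have := insert_None (inv_chain inv) (x := x); rewrite (inv_size inv) => /(_ xn).
case: (insert P x) => [Pq|] /= hI.
  by split=> // -[//|[_ _ /h]]; rewrite /= -hI.
by split=> // _; right; split=> //; apply/h; rewrite /= -hI.
Qed.

Lemma rsk_inj n w w' st : all (ltn^~ n) w -> all (ltn^~ n) w' ->
  rsk n w = Some st -> rsk n w' = Some st -> w = w'.
Proof.
elim/last_ind: w w' st => [|w x IHw] w' [P Q] aw aw' h h'.
  have := inv_sizeQ (rsk_invP aw h); have := inv_sizeQ (rsk_invP aw' h').
  by move=> -> /size0nil.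
case/lastP: w' aw' h' => [|w' x'] aw' h'.
  have := inv_sizeQ (rsk_invP aw h); have := inv_sizeQ (rsk_invP aw' h').
  by move=> ->; rewrite size_rcons.
move: aw aw' h h'; rewrite !all_rcons !rsk_rcons => /andP[xn aw] /andP[xn' aw'].
case E: (rsk n w) => [[P0 Q0]|] //=; case E': (rsk n w') => [[P0' Q0']|] //=.
case F: (insert P0 x) => [[P1 q]|] //= [<- <-].
case F': (insert P0' x') => [[P1' q']|] //= [e1 /rcons_inj[e2 e3]].
subst P1' Q0' q'.
have [eP ->] := insert_inj (inv_chain (rsk_invP aw E)) (inv_chain (rsk_invP aw' E')) F F'.
by rewrite (IHw _ _ aw aw' E) // E' eP.
Qed.

(** The last letter is recovered from the last step of the walk by undoing the
    insertion. *)
Lemma rsk_surj n P Q : is_chain P -> size P = n.+1 -> is_walk delta Q ->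
  top P = walk_end delta Q -> exists2 w, all (ltn^~ n) w & rsk n w = Some (P, Q).
Proof.
elim/last_ind: Q P => [|Q q IHQ] P cP sP.
  move=> _ /= tP; exists [::] => //; rewrite /rsk /=; congr Some; congr pair.
  (* In a chain with empty top, every shape is empty. *)
  elim: P n cP sP tP => // a [|b P] IHP [|n] //=.
    by move=> _ _ ->.
  move=> /is_chain_consP[/interlacesP[h1 _] cP b0] [sP] tP.
  rewrite -(IHP n cP) /= ?sP // /top /=; first by rewrite tP.
  apply/ffunP => i; apply/eqP; rewrite eq_le; apply/andP; split.
    by have := h1 i; rewrite tP.
  by rewrite [delta i]ffunE; exact: chamber_ge (is_chain_chamber cP) (b0 ord0).
rewrite is_walk_rcons walk_end_rcons => /andP[wQ cQ] tP.
have ha := walk_end_chamber (delta_chamber d) wQ.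
have a0 : 0 <= walk_end delta Q ord0.
  by apply: le_trans (walk_end_ge _ _ _); rewrite ffunE.
have [P0 [x [cP0 tP0 F]]] := insert_surj cP tP ha a0.
have [sP0 _] := insert_shape F.
have [|w aw E] := IHQ P0 cP0 _ wQ tP0; first by rewrite -sP0.
exists (rcons w x); last by rewrite rsk_rcons E /= F.
rewrite all_rcons aw andbT /=; have := insert_lt_size F.
by rewrite -sP0 sP.
Qed.

Variable r : nat.

Fixpoint walks (k : nat) a : seq (seq 'I_d) :=
  if k is k'.+1 then
    [seq q :: Q | q <- [seq q <- enum 'I_d | chamber (a +^ q)], Q <- walks k' (a +^ q)]
  else [:: [::]].

Lemma mem_walks k a Q : (Q \in walks k a) = (size Q == k) && is_walk a Q.
Proof.
elim: k a Q => [|k IHk] a Q /=; first by rewrite inE; case: Q.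
apply/allpairsPdep/andP => [[q [Q1 []]]|].
  by rewrite mem_filter IHk => /andP[cq _] /andP[/eqP sQ wQ] ->; rewrite /= sQ cq.
case: Q => [[]//|q Q /= [sQ /andP[cq wQ]]]; exists q, Q.
by rewrite mem_filter cq mem_enum IHk -eqSS sQ wQ.
Qed.

Lemma uniq_walks k a : uniq (walks k a).
Proof.
elim: k a => //= k IHk a; apply: allpairs_uniq_dep.
- by rewrite filter_uniq // enum_uniq.
- by move=> q _; exact: IHk.
- by move=> [q Q] [q' Q'] _ _ /= [-> ->].
Qed.

Lemma walk_sum_walks (V : nmodType) (F : vec -> V) k a :
  walk_sum F k a = \sum_(Q <- walks k a) F (walk_end a Q).
Proof.
elim: k a => [|k IHk] a /=; first by rewrite big_seq1.
rewrite big_allpairs_dep big_filter big_enum_cond /=.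
by apply: eq_bigr => q _; rewrite IHk.
Qed.

Lemma mem_chains n a P : (P \in chains r n a) <->
  [/\ is_chain P, size P = n.+1, top P = a &
    forall j, (j < n)%N -> content (level P j.+1) = content (level P j) + r%:Z].
Proof.
elim: n a P => [|n IHn] a P /=.
  case: eqP => [->|ne]; last first.
    by split=> // -[]; case: P => // b [] //= /eqP -> _ /esym.
  rewrite inE; split=> [/eqP ->|[]]; first by split=> //=.
  by case: P => // b [] //= /eqP ->.
split=> [/allpairsPdep[b [P1 []]]|[]].
  rewrite mem_filter mem_lowered => /andP[ba /andP[_ /eqP ct]].
  move=> /IHn[cP1 sP1 tP1 ctP1] ->.
  case: P1 cP1 sP1 tP1 ctP1 => // b1 P1 cP1 [sP1] tP1 ctP1; rewrite /top /= in tP1; subst b1.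
  split=> //; first by apply/andP.
    by rewrite /= sP1.
  move=> j; rewrite ltnS leq_eqVlt !(level_cons a) /= sP1 => /orP[/eqP ->|lt_j].
    by rewrite ltnn eqxx ltnSn level_cons -sP1 ltnn eqxx.
  by rewrite !ltnS lt_j (ltnW lt_j) ctP1.
case: P => // a' [|b P2] //= /andP[ba cP] [sP] tP ctP.
rewrite /top /= in tP; subst a'.
apply/allpairsPdep; exists b, (b :: P2); split=> //.
  rewrite mem_filter mem_lowered ba /=; apply/andP; split.
    by apply/forallP => q; have /interlacesP[] := ba.
  have := ctP n (ltnSn n); rewrite !(level_cons a) /= sP ltnn eqxx ltnSn level_cons -sP.
  by rewrite ltnn eqxx => ->.
apply/IHn; split=> //; first by rewrite /= sP.
move=> j lt_j; have := ctP j (ltnW lt_j).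
by rewrite !(level_cons a) /= sP !ltnS lt_j (ltnW lt_j).
Qed.

End WordBijection.

(** * Counting the words *)

Lemma count_ltnS (w : seq nat) j : count (ltn^~ j.+1) w = (count (ltn^~ j) w + count_mem j w)%N.
Proof.
elim: w => //= x w ->.
suff -> : (x < j.+1)%N = ((x < j) + (x == j))%N :> nat by lia.
by rewrite ltnS leq_eqVlt; case: eqP => [->|_] /=; rewrite ?ltnn ?addn0.
Qed.

Lemma has_increasing_ord n k (w : seq 'I_n) :
  has_increasing (map val w) n k <->
  [exists s : k.-tuple 'I_n, subseq s w && sorted (fun a b : 'I_n => (a < b)%N) s].
Proof.
split=> [[s [/subseqP[m sm ->] ss sk _]]|/existsP[s /andP[sw ss]]].
  move: ss sk; rewrite -map_mask size_map sorted_map => ss /eqP sk.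
  by apply/existsP; exists (Tuple sk); rewrite /= ss andbT mask_subseq.
exists (map val s); split.
- exact: map_subseq.
- by rewrite sorted_map.
- by rewrite size_map size_tuple.
- by apply/allP => x /mapP[y _ ->]; exact: ltn_ord.
Qed.

Section Counting.
Variables (d' r n : nat).
Local Notation d := d'.+1.
Local Notation vec := {ffun 'I_d -> int}.
Local Notation delta := (@delta d).

Definition words_avoiding : seq (seq nat) :=
  [seq map val (val w) | w <- enum (avoiding_words d.+1 r n)].

Lemma mem_words_avoiding w : (w \in words_avoiding) <->
  [/\ size w = (r * n)%N, all (ltn^~ n) w, ~ has_increasing w n d.+1 &
    forall j, (j < n)%N -> count_mem j w = r].
Proof.
split=> [/mapP[t]|[sw aw nw cw]].
  rewrite mem_enum inE => /andP[/forallP ct /negP nt] ->; split.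
  - by rewrite size_map size_tuple.
  - by apply/allP => x /mapP[y _ ->]; exact: ltn_ord.
  - by move=> /has_increasing_ord.
  - move=> j jn; rewrite count_map; apply: etrans (eqP (ct (Ordinal jn))).
    by apply: eq_count => y; rewrite /= -val_eqE.
pose s : seq 'I_n := pmap insub w.
have sE : map val s = w.
  by rewrite /s; elim: w aw {sw nw cw s} => //= x w IHw /andP[xn /IHw e]; rewrite insubT /= e.
have ss : size s == (r * n)%N by rewrite -sw -sE size_map.
apply/mapP; exists (Tuple ss); last by [].
rewrite mem_enum inE; apply/andP; split.
  apply/forallP => a; apply/eqP; apply: etrans (cw _ (ltn_ord a)).
  by rewrite -sE count_map; apply: eq_count => y; rewrite /= -val_eqE.
by apply/negP => /has_increasing_ord; rewrite sE.
Qed.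

Definition chain_walk_pairs : seq (seq vec * seq 'I_d) :=
  [seq (P, Q) | Q <- walks (r * n) delta, P <- chains r n (walk_end delta Q)].

Lemma mem_chain_walk_pairs P Q : ((P, Q) \in chain_walk_pairs) <->
  [/\ is_walk delta Q, size Q = (r * n)%N & P \in chains r n (walk_end delta Q)].
Proof.
split=> [/allpairsPdep[Q1 [P1 [h1 h2 [-> ->]]]]|[wQ sQ hP]].
  by move: h1; rewrite mem_walks => /andP[/eqP].
by apply/allpairsPdep; exists Q, P; rewrite mem_walks sQ eqxx.
Qed.

Lemma uniq_chains m a : uniq (@chains d r m a).
Proof.
elim: m a => [|m IHm] a /=; first by case: ifP.
apply: allpairs_uniq_dep => [|b _|]; first by rewrite filter_uniq // uniq_lowered.
  exact: IHm.
move=> [b P] [b' P'] /allpairsPdep[b1 [P1 [_ h1 [-> ->]]]].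
move=> /allpairsPdep[b2 [P2 [_ h2 [-> ->]]]] /= [e]; subst P2.
by move: h1 h2 => /mem_chains[_ _ <- _] /mem_chains[_ _ <- _].
Qed.

Lemma uniq_chain_walk_pairs : uniq chain_walk_pairs.
Proof.
apply: allpairs_uniq_dep; first exact: uniq_walks.
  by move=> Q _; exact: uniq_chains.
by move=> [Q P] [Q' P'] _ _ /= [-> ->].
Qed.

(** Words are counted through their images in an option type, because [rsk] is
    partial; it is defined on these words by [rsk_None]. *)
Lemma perm_rsk_pairs :
  perm_eq (map (@rsk d' n) words_avoiding) (map Some chain_walk_pairs).
Proof.
apply: uniq_perm.
- rewrite map_inj_in_uniq.
    rewrite map_inj_uniq ?enum_uniq // => w w' /(inj_map val_inj) e.
    exact: val_inj.
  move=> w w' /mem_words_avoiding[_ aw nw _] /mem_words_avoiding[_ aw' _ _] e.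
  case E: (rsk d' n w) => [st|]; last by case: nw; apply/(rsk_None _ aw).
  by apply: (rsk_inj aw aw' E); rewrite -e.
- by rewrite map_inj_uniq ?uniq_chain_walk_pairs // => x y [].
move=> st; apply/mapP/mapP => -[].
  move=> w /mem_words_avoiding[sw aw nw cw] ->.
  case E: (rsk d' n w) => [[P Q]|]; last by case: nw; apply/(rsk_None _ aw).
  exists (P, Q) => //; have inv := rsk_invP aw E.
  apply/mem_chain_walk_pairs; split; first exact: inv_walk inv.
    by rewrite (inv_sizeQ inv).
  apply/mem_chains; split.
  - exact: inv_chain inv.
  - exact: inv_size inv.
  - exact: inv_top inv.
  - move=> j jn; rewrite !(inv_content inv) ?(ltnW jn) // count_ltnS cw //.
    by rewrite PoszD addrA.
move=> [P Q] /mem_chain_walk_pairs[wQ sQ /mem_chains[cP sP tP ctP]] ->.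
have [w aw E] := rsk_surj cP sP wQ tP; exists w => //.
have inv := rsk_invP aw E; apply/mem_words_avoiding; split=> //.
- by rewrite -(inv_sizeQ inv).
- by move=> /(rsk_None _ aw); rewrite E.
move=> j jn; have := ctP j jn; rewrite !(inv_content inv) ?(ltnW jn) // count_ltnS.
lia.
Qed.

(** The Robinson-Schensted-Knuth correspondence, counted. *)
Lemma nb_avoiding_walk_sum : nb_avoiding d.+1 r n =
  walk_sum (fun b => size (chains r n b)) (r * n) delta.
Proof.
rewrite walk_sum_walks -[LHS](_ : size words_avoiding = _); last first.
  by rewrite size_map -cardE.
rewrite -(size_map (@rsk d' n)) (perm_size perm_rsk_pairs) size_map.
by rewrite size_allpairs_dep sumnE big_map.
Qed.

End Counting.

(** * The coefficients of both sides *)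

Lemma fpsC_exp (A : comNzRingType) (c : A) n : (fpsC c) ^+ n = fpsC (c ^+ n) :> fps A.
Proof.
elim: n => // n IHn; apply/fpsP => k; rewrite exprS IHn coef_fpsCM exprS /=.
by case: ifP; rewrite ?mulr0.
Qed.

Lemma coef_fps_monomial (A : comNzRingType) (c : A) n k :
  fps_coef (fpsX ^+ n * fpsC c) k = if k == n then c else 0.
Proof. by rewrite mulrC coef_fpsCM coef_fpsXn; case: eqP; rewrite ?mulr1 ?mulr0. Qed.

(** At most one [n] satisfies [l = r * n]. *)
Lemma sum_sparse (A : nmodType) (r l : nat) (a : nat -> A) : (0 < r)%N ->
  \sum_(n < l.+1) (if l == (r * n)%N then a n else 0) =
  if (r %| l)%N then a (l %/ r)%N else 0.
Proof.
move=> r0; case: ifP => [/dvdnP[n ->]|/negP ndv].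
  rewrite mulnK // mulnC.
  have lt_n : (n < (r * n).+1)%N by rewrite ltnS leq_pmull.
  rewrite (bigD1 (Ordinal lt_n)) //= eqxx big1 ?addr0 // => m ne.
  by rewrite eqn_pmul2l // ifN_eqC // eq_sym.
by rewrite big1 // => n _; case: eqP => // e; case: ndv; apply/dvdnP; exists n; rewrite mulnC.
Qed.

Lemma coef_exp_monomial (F : fieldType) (c : F) r l : (0 < r)%N ->
  fps_coef (fps_exp (fpsX ^+ r * fpsC c)) l =
  if (r %| l)%N then ((l %/ r)`!%:R)^-1 * c ^+ (l %/ r) else 0.
Proof.
move=> r0; rewrite -(sum_sparse l (fun n => (n`!%:R)^-1 * c ^+ n) r0).
apply: eq_bigr => n _; rewrite coef_fpsCM exprMn -exprM fpsC_exp coef_fps_monomial.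
by case: eqP; rewrite ?mulr0.
Qed.

Lemma coef_genfun (R : realType) d r k l : (0 < r)%N ->
  fps_coef (fps_coef (genfun R d r) k) l =
  if (k == l) && (r %| k)%N then
    (nb_avoiding d r (k %/ r))%:R / (k`!%:R * (k %/ r)`!%:R)
  else 0.
Proof.
move=> r0; pose c n : R[i] := (nb_avoiding d r n)%:R / ((r * n)`!%:R * n`!%:R).
transitivity (fps_coef (\sum_(n < k.+1)
    (if k == (r * n)%N then fpsC (c n) * fpsX ^+ (r * n) else 0)) l).
  congr (fps_coef _ l); apply: eq_bigr => n _.
  rewrite coef_fpsCM exprMn fpsC_exp coef_fps_monomial.
  by case: eqP; rewrite ?mulr0.
rewrite (sum_sparse k (fun n => fpsC (c n) * fpsX ^+ (r * n)) r0).
case: ifP => rk; last by rewrite andbF coef_fps0.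
have rkK : (r * (k %/ r))%N = k by rewrite mulnC divnK.
rewrite coef_fpsCM coef_fpsXn rkK andbT eq_sym /c rkK.
by case: eqP; rewrite ?mulr1 ?mulr0.
Qed.

Section IntegralCoefficient.
Variables (R : realType) (r d' : nat).
Local Notation C := R[i].
Local Notation d := d'.+1.

Definition det_coef k : {mpoly C[r]} := (k`!%:R)^-1 *:
  \sum_(s : 'S_d) (-1) ^+ s *: hwalk R r k (det_exponent s).

Definition exp_coef l : {mpoly C[r]} :=
  if (r %| l)%N then ((l %/ r)`!%:R)^-1 *: cycle_poly R r ^+ (l %/ r) else 0.

(** The determinant involves [v] only and the exponential [\bar v] only, so a
    coefficient of the integrand is a product of two values of polynomials. *)
Lemma coef_integrand k l (t : r.-tuple C) : (0 < r)%N ->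
  fps_coef (fps_coef (integrand d t) k) l =
  (det_coef k).@[tnth t] * Num.conj (exp_coef l).@[tnth t].
Proof.
move=> r0; rewrite /integrand mulrC coef_fpsCM mulrC coef_fpsCM coef_det_toeplitz.
congr (_ * _); rewrite coef_exp_monomial // /exp_coef.
case: ifP => _; last by rewrite meval0 rmorph0.
rewrite mevalZ (rmorphXn (meval (tnth t))) /= meval_cycle_poly [RHS]rmorphM; congr (_ * _).
  by rewrite [RHS]fmorphV rmorph_nat.
by rewrite [RHS]rmorphXn.
Qed.

Lemma pairing_coef k l : (0 < r)%N ->
  pairing (det_coef k) (exp_coef l) =
  if (k == l) && (r %| k)%N then
    (nb_avoiding d.+1 r (k %/ r))%:R / (k`!%:R * (k %/ r)`!%:R)
  else 0.
Proof.
move=> r0; rewrite /exp_coef; have [->|ne_kl] /= := eqVneq k l.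
  case: ifP => rl; last by rewrite pairing0r.
  rewrite pairingZl pairingZr pairing_suml fmorphV rmorph_nat.
  under eq_bigr do rewrite pairingZl.
  rewrite (pairing_det_hwalk R r ord0) nb_avoiding_walk_sum.
  rewrite [in RHS](_ : (r * _)%N = l); last by rewrite mulnC divnK.
  by rewrite invfM mulrA [LHS]mulrC.
case: ifP => rl; last by rewrite pairing0r.
rewrite pairingZl pairingZr pairing_suml.
under eq_bigr do rewrite pairingZl.
rewrite (pairing_det_hwalk R r ord0) walk_sum_eq0 ?mulr0 //.
by rewrite mulnC divnK // (inj_eq (addrI _)) eqz_nat.
Qed.

End IntegralCoefficient.

Theorem theorem1 (R : realType) (d r : nat) (hr : (1 <= r)%N) (hd : (1 <= d)%N) :
  genfun R d.+1 r = gauss_integral_fps (@integrand R r d).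
Proof.
case: d hd => // d' _; apply/fpsP => k; apply/fpsP => l.
rewrite coef_genfun //.
transitivity ((pi ^- r)%:C%C * iter_integralC (fun t : r.-tuple R[i] =>
    (det_coef R r d' k).@[tnth t] * Num.conj (exp_coef R r l).@[tnth t] *
    gauss_weight t)); last first.
  congr (_ * iter_integralC _); apply/funext => t.
  by rewrite coef_integrand.
rewrite iter_integralC_pairing pairing_coef // mulrA.
by rewrite -(rmorphM (real_complex R)) mulVf ?mul1r // expf_neq0 // gt_eqF // pi_gt0.
Qed.
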